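(* The sets $\mathcal{T}_n(132,312)$ and $\widetilde{\mathcal{T}}_n(123)$ are regular, flag, unimodular reverse lexicographic triangulations of $B_n(132,312)$ and $\widetilde{B}_n(123)$, respectively.
   Context: $B_n(132,312)$ is the convex hull in $\mathbb{R}^{n\times n}$ of the permutation matrices $M_\sigma$ of the permutations $\sigma\in\mathfrak{S}_n$ avoiding both $132$ and $312$; $\widetilde{B}_n(123)$ is the convex hull of the matrices of the alternating permutations $a_1<a_2>a_3<\cdots$ in $\mathfrak{S}_n$ avoiding $123$. $Q_n(132,312)$ is the right weak Bruhat order restricted to the $\{132,312\}$-avoiding permutations, and $\widetilde{Q}_n(123)$ is the left weak Bruhat order restricted to the alternating $123$-avoiding permutations. $\mathcal{T}_n(132,312)=\{\operatorname{conv}\{M_{\sigma_1},\dots,M_{\sigma_u}\} : \{\sigma_1,\dots,\sigma_u\}$ a chain in $Q_n(132,312)\}$, and $\widetilde{\mathcal{T}}_n(123)$ is defined the same way using chains of $\widetilde{Q}_n(123)$. A triangulation is flag if all its minimal nonfaces have two elements, unimodular if each simplex is unimodular with respect to the lattice $(\operatorname{aff} P)\cap\mathbb{Z}^{n\times n}$, regular if obtained by projecting lower facets of a lifting of the vertices, and reverse lexicographic if its Stanley-Reisner ideal is the radical of the initial ideal of the toric ideal of the polytope with respect to graded reverse lexicographic order, where variables $t_\sigma$ are ordered $t_{\sigma'}\succ t_\sigma$ whenever $\sigma'$ is lexicographically greater than $\sigma$. *)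

(* Defs.v *)
From HB Require Import structures.
From mathcomp Require Import all_boot all_order all_fingroup all_algebra.
From mathcomp Require Import classical_sets cardinality reals.
From mathcomp Require Import mpoly.

Set Implicit Arguments.
Unset Strict Implicit.
Unset Printing Implicit Defensive.

Import Order.TTheory GRing.Theory Num.Theory.

Local Open Scope classical_set_scope.
Local Open Scope ring_scope.

(* A permutation s : 'S_n has one-line notation s 0, s 1, ..., s (n-1), with
   positions and values shifted down by one. *)
Section Permutations.
Variable n : nat.
Implicit Types (s t : 'S_n) (A C : {set 'S_n}).

(* The pattern is given by its word, e.g. [:: 1; 3; 2]; only the relative
   order of its letters matters. *)
Definition contains_pattern (w : seq nat) s : bool :=
  [exists f : {ffun 'I_(size w) -> 'I_n},
    [forall i : 'I_(size w), forall j : 'I_(size w),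
      (i < j)%N ==> (f i < f j)%N] &&
    [forall i : 'I_(size w), forall j : 'I_(size w),
      (nth 0%N w i < nth 0%N w j)%N == (s (f i) < s (f j))%N]].

Definition avoids (w : seq nat) s : bool := ~~ contains_pattern w s.

(* a_1 < a_2 > a_3 < ...; the 0-based position i carries a_(i+1). *)
Definition alternating s : bool :=
  [forall i : 'I_n, forall j : 'I_n, (j == i.+1 :> nat) ==>
    (if odd i then (s j < s i)%N else (s i < s j)%N)].

(* MathComp composes permutations from left to right: (s * t) x = t (s x).
   Hence tperm i j * s exchanges the letters in the positions i and j of s,
   and s * tperm i j exchanges the values i and j. *)
Definition right_weak_cover : rel 'S_n := fun s t =>
  [exists i : 'I_n, exists j : 'I_n,
    [&& j == i.+1 :> nat, (s i < s j)%N & t == (tperm i j * s)%g]].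

Definition left_weak_cover : rel 'S_n := fun s t =>
  [exists i : 'I_n, exists j : 'I_n,
    [&& j == i.+1 :> nat, ((s^-1)%g i < (s^-1)%g j)%N
      & t == (s * tperm i j)%g]].

Definition right_weak_le : rel 'S_n := connect right_weak_cover.
Definition left_weak_le : rel 'S_n := connect left_weak_cover.

(* Chains of the order [le] restricted to A. *)
Definition chain_in (le : rel 'S_n) A C : bool :=
  (C \subset A) && [forall s in C, forall t in C, le s t || le t s].

Definition perm_lex_lt : rel 'S_n := fun s t =>
  [exists i : 'I_n, (s i < t i)%N &&
    [forall j : 'I_n, (j < i)%N ==> (s j == t j)]].

Definition Av_132_312 : {set 'S_n} :=
  [set s : 'S_n | avoids [:: 1; 3; 2]%N s && avoids [:: 3; 1; 2]%N s]%SET.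

Definition altAv_123 : {set 'S_n} :=
  [set s : 'S_n | alternating s && avoids [:: 1; 2; 3]%N s]%SET.

End Permutations.

Section ConvexGeometry.
Variables (R : realFieldType) (V : lmodType R).
Implicit Types (X S F P L : set V) (T : set (set V)).

Definition convex_hull X : set V :=
  [set x | exists (k : nat) (v : 'I_k -> V) (c : 'I_k -> R),
    [/\ forall i, X (v i), forall i, 0 <= c i, \sum_i c i = 1
      & x = \sum_i c i *: v i]].

Definition affine_hull X : set V :=
  [set x | exists (k : nat) (v : 'I_k -> V) (c : 'I_k -> R),
    [/\ forall i, X (v i), \sum_i c i = 1 & x = \sum_i c i *: v i]].

Definition int_affine_hull X : set V :=
  [set x | exists (k : nat) (v : 'I_k -> V) (c : 'I_k -> int),
    [/\ forall i, X (v i), \sum_i c i = 1 & x = \sum_i (c i)%:~R *: v i]].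

Definition affinely_independent (k : nat) (v : 'I_k -> V) : Prop :=
  forall c : 'I_k -> R,
    \sum_i c i = 0 -> \sum_i c i *: v i = 0 -> forall i, c i = 0.

(* The empty set is the simplex with no vertex. *)
Definition is_simplex S : Prop :=
  exists (k : nat) (v : 'I_k -> V),
    affinely_independent v /\ S = convex_hull (range v).

(* The empty set and P itself are faces of P: take l = 0. *)
Definition is_face P F : Prop :=
  exists (l : {scalar V}) (c : R),
    (forall x, P x -> l x <= c) /\ F = P `&` [set x | l x = c].

Definition vertices P : set V := [set x | is_face P [set x]].

Definition triangulation P T : Prop :=
  [/\ finite_set T,
      forall S, T S -> is_simplex S,
      forall S F, T S -> is_face S F -> T F,
      forall S1 S2, T S1 -> T S2 ->
        is_face S1 (S1 `&` S2) /\ is_face S2 (S1 `&` S2)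
    & \bigcup_(S in T) S = P].

(* The abstract simplicial complex formed by the vertex sets of the cells. *)
Definition abstract_complex T : set (set V) := [set vertices S | S in T].

Definition minimal_nonface T X : Prop :=
  [/\ X `<=` \bigcup_(S in T) vertices S,
      ~ abstract_complex T X
    & forall Y, Y `<` X -> abstract_complex T Y].

Definition flag T : Prop :=
  forall X, minimal_nonface T X -> exists a b, a <> b /\ X = [set a; b].

(* L is an affine lattice.  If S spans the affine hull of L, the second
   condition says that the vertices of S affinely generate L; in general, it
   says that they generate the part of L in the affine hull of S. *)
Definition unimodular_simplex L S : Prop :=
  vertices S `<=` L /\ L `&` affine_hull S `<=` int_affine_hull (vertices S).

Definition unimodular L T : Prop := forall S, T S -> unimodular_simplex L S.

Definition lifted_polytope P (h : V -> R) : set (V * R)%type :=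
  [set z | exists (k : nat) (v : 'I_k -> V) (c : 'I_k -> R),
    [/\ forall i, vertices P (v i), forall i, 0 <= c i, \sum_i c i = 1
      & z = (\sum_i c i *: v i, \sum_i c i * h (v i))]].

Definition lower_face (Q G : set (V * R)%type) : Prop :=
  exists (l : {scalar V}) (c : R),
    (forall z, Q z -> c <= l z.1 + z.2) /\
    G = Q `&` [set z | l z.1 + z.2 = c].

(* Maximality, rather than a condition on the dimension, also covers the case
   of an affine h, where the lifted polytope is its own only lower facet. *)
Definition lower_facet (Q G : set (V * R)%type) : Prop :=
  lower_face Q G /\ forall G', lower_face Q G' -> G `<=` G' -> G' = G.

Definition regular P T : Prop :=
  exists h : V -> R,
    T = [set S | exists2 G, lower_facet (lifted_polytope P h) G
                          & is_face (fst @` G) S].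

End ConvexGeometry.

Section PermutationPolytopes.
Variables (R : realFieldType) (n : nat).
Implicit Types A C : {set 'S_n}.

Definition perm_points C : set 'M[R]_n := [set perm_mx s | s in [set` C]].

Definition perm_polytope A : set 'M[R]_n := convex_hull (perm_points A).

Definition integer_points : set 'M[R]_n :=
  range (fun Z : 'M[int]_n => map_mx intr Z).

(* The empty chain contributes the empty face. *)
Definition chain_cells (le : rel 'S_n) A : set (set 'M[R]_n) :=
  [set convex_hull (perm_points C) | C in [set C | chain_in le A C]].

End PermutationPolytopes.

Section Ideals.
Variable D : comNzRingType.
Implicit Types I G : set D.

Definition ideal_gen G : set D :=
  [set p | exists (k : nat) (a g : 'I_k -> D),
    (forall i, G (g i)) /\ p = \sum_i a i * g i].

Definition radical I : set D := [set p | exists k : nat, I (p ^+ k)].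

End Ideals.

Section ReverseLexicographic.
Variables (K : fieldType) (n : nat) (A : {set 'S_n}).

(* The variable 'X_i stands for t_s, where s = var_perm i runs through A. *)
Local Notation S := {mpoly K[#|A|]}.

Definition var_perm (i : 'I_#|A|) : 'S_n := enum_val i.

Definition var_lt (i j : 'I_#|A|) : bool :=
  perm_lex_lt (var_perm i) (var_perm j).

(* The mpoly library compares monomials in a different way, so its lead
   monomial mlead is not the one needed here. *)
Definition grevlex_lt (m1 m2 : 'X_{1..#|A|}) : bool :=
  (mdeg m1 < mdeg m2)%N ||
  (mdeg m1 == mdeg m2) &&
  [exists i : 'I_#|A|, (m2 i < m1 i)%N &&
    [forall j : 'I_#|A|, var_lt j i ==> (m1 j == m2 j)]].

Definition leading_monomial (p : S) (m : 'X_{1..#|A|}) : Prop :=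
  m \in msupp p /\ forall m', m' \in msupp p -> m' != m -> grevlex_lt m' m.

Definition initial_ideal (I : set S) : set S :=
  ideal_gen [set 'X_[m] | m in
    [set m | exists2 p, I p & leading_monomial p m]].

(* t_s is sent to x^(M_s) z: the entries of a matrix variable x are the
   variables of {mpoly K[n * n]}, and z is the indeterminate of the outer
   {poly _}, which makes the toric ideal homogeneous. *)
Definition toric_map : S -> {poly {mpoly K[n * n]}} :=
  mmap (fun c : K => (c%:MP)%:P)
    (fun i => (\prod_(r < n) \prod_(c < n)
                 'X_(mxvec_index r c) ^+ (var_perm i r == c))%:P * 'X).

Definition toric_ideal : set S := [set p | toric_map p = 0].

Definition stanley_reisner_ideal (R : realFieldType)
    (T : set (set 'M[R]_n)) : set S :=
  ideal_gen [set \prod_(i in N) 'X_i | N in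
    [set N : {set 'I_#|A|} |
      ~ abstract_complex T (perm_points [set var_perm i | i in N]%SET)]].

Definition reverse_lexicographic (R : realFieldType)
    (T : set (set 'M[R]_n)) : Prop :=
  stanley_reisner_ideal T = radical (initial_ideal toric_ideal).

End ReverseLexicographic.

(* Main.v *)
(** In both families the inversion sets of the permutations are closed under
    unions and intersections, so that the weak order restricted to the family is
    a distributive lattice, and the entries of the matrix M_s and the indicators
    of the inversions of s are integral affine functions of each other.  Hence
    M_s + M_t is the sum of the matrices of the meet and of the join of s and t,
    and the polytope is an order polytope up to a unimodular change of
    coordinates.  On a chain, membership in an up-set is the indicator of a
    single inversion, which makes the barycentric coordinates integral affine.
    The height -(number of inversions)^2 is strictly submodular, so the sets on
    which a supporting function is tight are chains; level sets write every point
    with a chain as support.  In the toric ideal, t_s t_t - t_(meet) t_(join) has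
    leading term t_s t_t when s and t are incomparable, while monomials supported
    on chains are the smallest of their fibres. *)

Require Import Defs.
From HB Require Import structures.
From mathcomp Require Import all_boot all_order all_fingroup all_algebra.
From mathcomp Require Import boolp classical_sets cardinality reals.
From mathcomp Require Import mpoly zify ring lra.

Set Implicit Arguments.
Unset Strict Implicit.
Unset Printing Implicit Defensive.

Import Order.TTheory GRing.Theory Num.Theory.

Local Open Scope classical_set_scope.
Local Open Scope ring_scope.

(** * The weak orders and inversions *)

Section WeakOrder.
Variable n : nat.
Implicit Types s t u : 'S_n.

(** What is particular to each family is the affine dictionary between entries and inversions, and
    it rests on a rigidity of the pattern class. For alternating permutations avoiding 123, two
    positions can change their relative order within the family only if one is a valley and the
    other is not. Three positions cannot be pairwise of this kind, which makes the comparison of the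
    letters at [l] and [r] a threshold condition on the letter at [r] alone. For 132 and 312, the
    middle one of three values never comes last, so the position of a value [c] is decided by
    comparing [c] with the values [c - m] and [c + m]. Everything else uses only the record
    [order_coding]. Its coordinates are all pairs instead of the join-irreducible elements: some
    coordinates are then constant on the family, but no representation theorem for distributive
    lattices is called for. Coefficients are kept in [int] because the same identities serve
    convexity over [R], membership in the lattice, and exponents of monomials over a field of any
    characteristic. *)

Definition inversion s (p : 'I_n * 'I_n) : bool :=
  (p.1 < p.2)%N && (s p.2 < s p.1)%N.

(** The values rise by at least one per step, so [q i] is at least [i] counting from position 0, and
    at most [i] counting back from position [n - 1]. *)
Lemma perm_increasing_id (q : 'S_n) :
  (forall i j : 'I_n, j = i.+1 :> nat -> (q i < q j)%N) -> q = 1%g.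
Proof.
move=> incr.
have grow k (i j : 'I_n) : j = (i + k)%N :> nat -> (q i + k <= q j)%N.
  elim: k j => [|k IHk] j; last move=> eqj.
    by rewrite !addn0 => /val_inj ->.
  have ltk : (i + k < n)%N by have := ltn_ord j; lia.
  have := IHk (Ordinal ltk) erefl; have := incr (Ordinal ltk) j; rewrite /= eqj.
  lia.
apply/permP=> i; rewrite perm1; apply/val_inj => /=.
have n_gt0 : (0 < n)%N by have := ltn_ord i; lia.
have lastP : (n.-1 < n)%N by lia.
have := grow i (Ordinal n_gt0) i (esym (add0n i)).
have := grow (n.-1 - i)%N i (Ordinal lastP).
have := ltn_ord (q (Ordinal lastP)); have := ltn_ord i; rewrite /=; lia.
Qed.

(** This is why a left cover creates a single inversion: exchanging two consecutive values disturbs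
    no other comparison. *)
Lemma tperm_adjacent_lt (i j x y : 'I_n) : j = i.+1 :> nat -> (x < y)%N ->
  (x, y) != (i, j) -> (tperm i j x < tperm i j y)%N.
Proof.
have val_neq (a b : 'I_n) : a <> b -> a <> b :> nat by move=> ab /val_inj.
rewrite xpair_eqE -!(inj_eq val_inj) /= => ji.
case: (tpermP i j x) => [->|->|/val_neq + /val_neq];
  case: (tpermP i j y) => [->|->|/val_neq + /val_neq]; lia.
Qed.

Lemma inversion_left_cover s t : left_weak_cover s t ->
  forall p, inversion s p -> inversion t p.
Proof.
case/existsP=> i /existsP[j /and3P[/eqP ji lt_ij /eqP->]] [a b].
rewrite /inversion /= !permM => /andP[ab sba]; rewrite ab /=.
apply: tperm_adjacent_lt => //; apply: contraTneq lt_ij => -[<- <-].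
by rewrite !permK -leqNgt ltnW.
Qed.

(** For the converse, induct on the number of non-inversions of [s]. If [s] differs from [t], some
    consecutive values [i], [i+1] stand in order in [s] and out of order in [t]; otherwise
    [s^-1 * t] would be increasing, hence trivial. Exchanging them in [s] adds one inversion, which
    belongs to [t], so the cover stays below [t]. *)
Lemma left_weak_leP s t :
  reflect (forall p, inversion s p -> inversion t p) (left_weak_le s t).
Proof.
apply: (iffP connectP) => [[q + ->] p|].
  elim: q s => //= u q IHq s /andP[su qu] /(inversion_left_cover su).
  exact: IHq.
have [k] := ubnP #|[set p | ~~ inversion s p]%SET|.
elim: k s => // k IHk s ltk sub_st.
have [->|neq_st] := eqVneq s t; first by exists [::].
have [i [j [ji sij tji]]] : exists i j : 'I_n, [/\ j = i.+1 :> nat,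
    (s^-1%g i < s^-1%g j)%N & (t (s^-1%g j) < t (s^-1%g i))%N].
  apply: contrapT => no_ascent; case/eqP: neq_st.
  suff st1 : (s^-1 * t)%g = 1%g by apply/eqP; rewrite eq_mulVg1 st1.
  apply: perm_increasing_id => i j ji; rewrite !permM.
  have [sij|sji|/val_inj/perm_inj eqij] :=
    ltngtP (s^-1%g i) (s^-1%g j); last by move: ji; rewrite eqij; lia.
  - rewrite ltnNge; apply/negP; rewrite leq_eqVlt => /predU1P[|tji].
      by move/val_inj/perm_inj/perm_inj => eqij; move: ji; rewrite eqij; lia.
    by apply: no_ascent; exists i, j.
  - have /sub_st : inversion s (s^-1%g j, s^-1%g i).
      by rewrite /inversion /= sji !permKV ji ltnSn.
    by case/andP.
pose u := (s * tperm i j)%g.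
have su : left_weak_cover s u.
  by apply/existsP; exists i; apply/existsP; exists j; rewrite ji sij !eqxx.
have sub_su := inversion_left_cover su.
have iu : inversion u (s^-1%g i, s^-1%g j).
  by rewrite /inversion /= sij !permM !permKV tpermL tpermR ji ltnSn.
have inv_u p : inversion u p -> inversion s p \/ p = (s^-1%g i, s^-1%g j).
  case: p => a b; rewrite /inversion /= !permM => /andP[ab].
  rewrite ab /= => uba; have [|sab] := ltnP (s b) (s a); first by left.
  right; have sab' : (s a < s b)%N.
    rewrite ltn_neqAle sab andbT; apply: contraTneq ab => /val_inj/perm_inj->.
    by rewrite ltnn.
  have [[<- <-]|neq] := eqVneq (s a, s b) (i, j); first by rewrite !permK.
  by have := tperm_adjacent_lt ji sab' neq; rewrite ltnNge ltnW.
have [||q uq eqt] := IHk u; last by exists (u :: q); rewrite //= su.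
  rewrite -ltnS; apply: leq_trans ltk; rewrite ltnS; apply: proper_card.
  apply/properP; split.
    by apply/fintype.subsetP=> p; rewrite !inE; apply: contra; apply: sub_su.
  exists (s^-1%g i, s^-1%g j); rewrite !inE ?iu //.
  by rewrite /inversion /= sij !permKV ji; lia.
move=> p /inv_u[|->]; first exact: sub_st.
by rewrite /inversion /= sij tji.
Qed.

(** Taking inverses turns left multiplication by [tperm i j] into right multiplication. The right
    order is therefore handled through the inversions of [s^-1], that is, through pairs of
    values. *)
Lemma right_weak_le_inv s t :
  right_weak_le s t = left_weak_le s^-1%g t^-1%g.
Proof.
have cover_inv u v : right_weak_cover u v = left_weak_cover u^-1%g v^-1%g.
  apply: eq_existsb => i; apply: eq_existsb => j; rewrite !invgK.
  by rewrite -[v in LHS]invgK -(inj_eq invg_inj) invgK invMg tpermV.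
apply/connectP/connectP => -[p].
  elim: p s => /= [|u p IHp] s; first by move=> _ ->; exists [::].
  case/andP; rewrite cover_inv => su /IHp + eqt => /(_ eqt)[q uq eqt'].
  by exists (u^-1%g :: q); rewrite //= su.
elim: p s => /= [|u p IHp] s.
  by move=> _ /invg_inj->; exists [::].
case/andP => su; rewrite -[u]invgK => /IHp + eqt => /(_ eqt)[q uq eqt'].
by exists (u^-1%g :: q); rewrite //= cover_inv invgK su.
Qed.

Lemma perm_lex_lt_trans : transitive (@perm_lex_lt n).
Proof.
move=> t s u /existsP[i /andP[sti /forallP eq_i]].
case/existsP=> j /andP[tuj /forallP eq_j]; apply/existsP.
have [ij|ji|/val_inj eqij] := ltngtP i j.
- exists i; rewrite -(eqP (implyP (eq_j i) ij)) sti /=; apply/forallP=> k.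
  apply/implyP=> ki; rewrite (eqP (implyP (eq_i k) ki)).
  exact: (implyP (eq_j k)) (ltn_trans ki ij).
- exists j; rewrite (eqP (implyP (eq_i j) ji)) tuj /=; apply/forallP=> k.
  apply/implyP=> kj; rewrite -(eqP (implyP (eq_j k) kj)).
  exact: (implyP (eq_i k)) (ltn_trans kj ji).
- subst j; exists i; rewrite (ltn_trans sti tuj); apply/forallP=> k.
  apply/implyP=> ki; rewrite (eqP (implyP (eq_i k) ki)).
  exact: (implyP (eq_j k)).
Qed.

Lemma perm_lex_lt_irr : irreflexive (@perm_lex_lt n).
Proof. by move=> s; apply/existsP=> -[i]; rewrite ltnn. Qed.

(** Both weak orders satisfy the hypothesis on [e]: a cover exchanges two letters standing in
    increasing order, so the first position that changes receives the larger letter. This is the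
    link between the weak orders and the order of the variables. *)
Lemma connect_lex_lt (e : rel 'S_n) s t : subrel e (@perm_lex_lt n) ->
  connect e s t -> s != t -> perm_lex_lt s t.
Proof.
move=> sub_e /connectP[p]; elim: p s => [|u p IHp] s /=.
  by move=> _ ->; rewrite eqxx.
case/andP=> /sub_e su pu eqt _; have [<-//|] := eqVneq u t.
by move/(IHp u pu eqt); apply: perm_lex_lt_trans.
Qed.

Lemma left_weak_le_lex s t : left_weak_le s t -> s != t -> perm_lex_lt s t.
Proof.
apply: connect_lex_lt => {s t} s t /existsP[i /existsP[j /and3P[/eqP ji]]].
move=> lt_ij /eqP->; apply/existsP; exists (s^-1%g i); apply/andP; split.
  by rewrite permM permKV tpermL ji.
apply/forallP=> k; apply/implyP=> ki; rewrite permM tpermD //.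
  by apply: contraTneq ki => ->; rewrite permK ltnn.
by apply: contraTneq ki => eqj; rewrite -leqNgt ltnW // -[k](permK s) -eqj.
Qed.

Lemma right_weak_le_lex s t : right_weak_le s t -> s != t -> perm_lex_lt s t.
Proof.
apply: connect_lex_lt => {s t} s t /existsP[i /existsP[j /and3P[/eqP ji]]].
move=> lt_ij /eqP->; apply/existsP; exists i; apply/andP; split.
  by rewrite permM tpermL.
apply/forallP=> k; apply/implyP=> ki; rewrite permM tpermD //;
  by apply: contraTneq ki => <-; rewrite ?ji ?ltnn // -leqNgt.
Qed.

End WeakOrder.

(** * Integral affine functions and lattices of inversion sets *)

Section IntAffine.
Variable n : nat.
Implicit Types (A C : {set 'S_n}) (f g : 'S_n -> int).

(** The sum [\sum_r Z r (s r)] is the pairing of [Z] with the matrix of [s], so these are the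
    restrictions to [C] of affine functions of the matrix with integer coefficients. *)
Definition int_affine C f : Prop :=
  exists (z : int) (Z : 'M[int]_n), {in C, forall s, f s = z + \sum_r Z r (s r)}.

Lemma eq_int_affine C f g : {in C, f =1 g} -> int_affine C f -> int_affine C g.
Proof. by move=> fg [z [Z fE]]; exists z, Z => s Cs; rewrite -fg ?fE. Qed.

Lemma int_affineS C A f : C \subset A -> int_affine A f -> int_affine C f.
Proof. by move=> /fintype.subsetP CA [z [Z fE]]; exists z, Z => s /CA/fE. Qed.

Lemma int_affine_cst C z : int_affine C (fun=> z).
Proof. by exists z, 0 => s _; rewrite big1 ?addr0 // => r _; rewrite mxE. Qed.

Lemma int_affineD C f g :
  int_affine C f -> int_affine C g -> int_affine C (fun s => f s + g s).
Proof.
move=> [z [Z fE]] [y [Y gE]]; exists (z + y), (Z + Y) => s Cs.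
rewrite fE ?gE // addrACA -big_split /=; congr (_ + _).
by apply: eq_bigr => r _; rewrite mxE.
Qed.

Lemma int_affineN C f : int_affine C f -> int_affine C (fun s => - f s).
Proof.
move=> [z [Z fE]]; exists (- z), (- Z) => s Cs.
by rewrite fE // opprD -sumrN; congr (_ + _); apply: eq_bigr => r _; rewrite mxE.
Qed.

Lemma int_affineB C f g :
  int_affine C f -> int_affine C g -> int_affine C (fun s => f s - g s).
Proof. by move=> afff affg; apply: int_affineD => //; apply: int_affineN. Qed.

Lemma int_affine_sum C (I : Type) (r : seq I) (P : pred I) (F : I -> 'S_n -> int) :
  (forall i, P i -> int_affine C (F i)) ->
  int_affine C (fun s => \sum_(i <- r | P i) F i s).
Proof.
move=> affF; elim: r => [|i r IHr].
  by apply: eq_int_affine (int_affine_cst _ 0) => s _; rewrite big_nil.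
have [Pi|nPi] := boolP (P i); last first.
  by apply: eq_int_affine IHr => s _; rewrite big_cons (negPf nPi).
apply: eq_int_affine (int_affineD (affF i Pi) IHr) => s _.
by rewrite big_cons Pi.
Qed.

Lemma int_affine_entry C r c : int_affine C (fun s => (s r == c)%:Z).
Proof.
exists 0, (delta_mx r c) => s _; rewrite add0r (bigD1 r) //= mxE eqxx natz /=.
by rewrite big1 ?addr0 // => i /negPf ir; rewrite mxE ir.
Qed.

End IntAffine.

Lemma ltr_sum_ex (R : numDomainType) (I : finType) (F G : I -> R) (i : I) :
  (forall j, F j <= G j) -> F i < G i -> \sum_j F j < \sum_j G j.
Proof.
move=> leFG ltFG; rewrite (bigD1 i) // [ltRHS](bigD1 i) //=.
by apply: ltr_leD => //; apply: ler_sum.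
Qed.

(** [d s] will be the inversion set of [s] or of [s^-1]. [coding_form] and [coding_entry] are the
    two directions of the unimodular change of coordinates; meet and join make the image of [d] a
    lattice of sets; [coding_lex] is what the monomial order requires. *)
Record order_coding n (J : finType) (le : rel 'S_n) (A : {set 'S_n})
    (d : 'S_n -> {set J}) : Prop := OrderCoding {
  coding_form : forall j, int_affine A (fun s => (j \in d s)%:Z);
  coding_entry : forall r c : 'I_n, exists (u0 : int) (u : J -> int),
    {in A, forall s : 'S_n, (s r == c)%:Z = u0 + \sum_j u j * (j \in d s)%:Z};
  coding_meet : {in A &, forall s t : 'S_n, exists2 m, m \in A & d m = d s :&: d t};
  coding_join : {in A &, forall s t : 'S_n, exists2 m, m \in A & d m = d s :|: d t};
  coding_le : {in A &, forall s t : 'S_n, le s t = (d s \subset d t)};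
  coding_lex : {in A &, forall s t : 'S_n, le s t -> s != t -> perm_lex_lt s t}
}.

(** * Chains, heights and level sets in a coded family *)

Section Coding.
Variables (n : nat) (J : finType) (le : rel 'S_n) (A : {set 'S_n}).
Variable (d : 'S_n -> {set J}).
Hypothesis cod : order_coding le A d.
Implicit Types (s t m p : 'S_n) (C U W : {set 'S_n}).

Lemma coding_inj : {in A &, injective d}.
Proof.
move=> s t As At eqd; apply/permP=> r; apply/eqP; rewrite eq_sym.
have [u0 [u uE]] := coding_entry cod r (s r).
have := uE s As; rewrite eqd -uE // eqxx.
by case: (t r == s r).
Qed.

(** Indicators of membership are modular: those of two sets add up to those of their intersection
    and union. Entries are affine in these indicators. *)
Lemma meet_join_entry s t m p : s \in A -> t \in A -> m \in A -> p \in A ->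
  d m = d s :&: d t -> d p = d s :|: d t -> forall r c,
  (s r == c)%:Z + (t r == c)%:Z = (m r == c)%:Z + (p r == c)%:Z.
Proof.
move=> As At Am Ap dm dp r c; have [u0 [u uE]] := coding_entry cod r c.
rewrite !uE // [LHS]addrACA [RHS]addrACA; congr (_ + _); rewrite -!big_split /=.
apply: eq_bigr => j _; rewrite dm dp !inE -!mulrDr; congr (_ * _).
by case: (j \in d s); case: (j \in d t).
Qed.

Lemma meet_join_int_affine f s t m p :
  s \in A -> t \in A -> m \in A -> p \in A ->
  d m = d s :&: d t -> d p = d s :|: d t -> int_affine A f ->
  f s + f t = f m + f p.
Proof.
move=> As At Am Ap dm dp [z [Z fE]]; rewrite !fE // [LHS]addrACA [RHS]addrACA.
congr (_ + _); rewrite -!big_split /=; apply: eq_bigr => r _.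
have entryE q : Z r (q r) = \sum_c Z r c * (q r == c)%:Z.
  rewrite (bigD1 (q r)) //= eqxx mulr1 big1 ?addr0 // => c /negPf.
  by rewrite eq_sym => ->; rewrite mulr0.
rewrite !entryE -!big_split /=; apply: eq_bigr => c _.
by rewrite -!mulrDr (meet_join_entry As At Am Ap dm dp).
Qed.

Section Chain.
Variable C : {set 'S_n}.
Hypothesis chainC : chain_in le A C.

Lemma chain_sub : C \subset A.
Proof. by case/andP: chainC. Qed.

Lemma chain_mem s : s \in C -> s \in A.
Proof. exact: (fintype.subsetP chain_sub). Qed.

Lemma chain_comparable s t : s \in C -> t \in C ->
  (d s \subset d t) || (d t \subset d s).
Proof.
move=> Cs Ct; rewrite -!(coding_le cod) ?chain_mem //.
by case/andP: chainC => _ /forall_inP/(_ s Cs)/forall_inP/(_ t Ct).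
Qed.

Lemma chain_min U : U \subset C -> U != finset.set0 ->
  exists2 s, s \in U & {in U, forall t, d s \subset d t}.
Proof.
move=> /fintype.subsetP UC /set0Pn[s0 Us0].
case: (@arg_minnP _ s0 (mem U) (fun s => #|d s|)) => // s Us min_s.
exists s => // t Ut; case/orP: (chain_comparable (UC s Us) (UC t Ut)) => // ts.
by rewrite (eqP (_ : d s == d t)) // eq_sym eqEcard ts min_s.
Qed.

Lemma chain_max U : U \subset C -> U != finset.set0 ->
  exists2 s, s \in U & {in U, forall t, d t \subset d s}.
Proof.
move=> /fintype.subsetP UC /set0Pn[s0 Us0].
case: (@arg_maxnP _ s0 (mem U) (fun s => #|d s|)) => // s Us max_s.
exists s => // t Ut; case/orP: (chain_comparable (UC t Ut) (UC s Us)) => // st.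
by rewrite (eqP (_ : d s == d t)) // eqEcard st; apply: max_s.
Qed.

Lemma chain_upset_int_affine U :
  {in C &, forall s t, s \in U -> d s \subset d t -> t \in U} ->
  int_affine C (fun s => (s \in U)%:Z).
Proof.
move=> upU; have [CU0|CU] := eqVneq (C :&: U)%SET finset.set0.
  apply: eq_int_affine (int_affine_cst C 0) => s Cs.
  by have := finset.in_set0 s; rewrite -CU0 inE Cs /= => ->.
have [CD0|CD] := eqVneq (C :\: U)%SET finset.set0.
  apply: eq_int_affine (int_affine_cst C 1) => s Cs.
  by have := finset.in_set0 s; rewrite -CD0 inE Cs andbT => /negbFE ->.
have [s1] := chain_min (subsetIl C U) CU; rewrite inE => /andP[Cs1 Us1] min_s1.
have [s0] := chain_max (subsetDl C U) CD; rewrite inE => /andP[nUs0 Cs0] max_s0.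
(* [j] separates the least member of [U] in the chain from the greatest non-member, hence every
   member from every non-member. *)
have /subsetPn[j js1 js0] : ~~ (d s1 \subset d s0).
  by apply: contra nUs0; apply: upU.
apply: eq_int_affine (int_affineS chain_sub (coding_form cod j)) => s Cs.
have [Us|nUs] := boolP (s \in U).
  by rewrite (fintype.subsetP (min_s1 s _) j js1) // inE Cs.
by rewrite (contraNF (fintype.subsetP (max_s0 s _) j) js0) // inE nUs.
Qed.

(** The indicator of [s] is the difference of the indicators of two up-sets, the elements above [s]
    and those strictly above [s]. *)
Lemma chain_coordinate s : s \in C -> int_affine C (fun t => (t == s)%:Z).
Proof.
move=> Cs.
have aff_ge : int_affine C (fun t => (t \in [set t | d s \subset d t]%SET)%:Z).
  by apply: chain_upset_int_affine => t u _ _; rewrite !inE; apply: fintype.subset_trans.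
have aff_gt : int_affine C
    (fun t => (t \in [set t | (d s \subset d t) && (t != s)]%SET)%:Z).
  apply: chain_upset_int_affine => t u Ct Cu; rewrite !inE => /andP[st neq_ts] tu.
  rewrite (fintype.subset_trans st tu); apply: contraNneq neq_ts => us.
  apply/eqP/coding_inj; rewrite ?chain_mem //; apply/eqP.
  by rewrite finset.eqEsubset st -us tu.
apply: eq_int_affine (int_affineB aff_ge aff_gt) => t Ct; rewrite !inE.
by have [->|_] := eqVneq t s; rewrite ?subxx ?andbT ?andbF ?subr0 ?subrr.
Qed.

End Chain.

(** This is the square of the cardinality of [d s], written as a count of ordered pairs so that
    supermodularity can be checked one pair at a time. *)
Definition height s : int := \sum_(i : J * J) ((i.1 \in d s) && (i.2 \in d s))%:Z.

(** Strictness comes from a pair [(i, j)] with [i] only in [d s] and [j] only in [d t]: the join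
    alone counts it. *)
Lemma height_supermodular s t m p :
  d m = d s :&: d t -> d p = d s :|: d t ->
  ~~ (d s \subset d t) -> ~~ (d t \subset d s) ->
  height s + height t < height m + height p.
Proof.
move=> dm dp /subsetPn[i si nti] /subsetPn[j tj nsj].
rewrite -!big_split /=; apply: (ltr_sum_ex (i := (i, j))) => [k|] /=.
  rewrite dm dp !inE.
  by case: (_ \in d s); case: (_ \in d t); case: (_ \in d s); case: (_ \in d t).
by rewrite dm dp !inE si tj (negPf nti) (negPf nsj).
Qed.

(* Along the chain one of any two indices i, j enters last, so on C the product
   of their indicators is the indicator of that last one; elsewhere it is at
   most that. *)
Lemma chain_support C : chain_in le A C ->
  exists f, [/\ int_affine A f, forall s, height s <= f s &
    {in C, forall s, height s = f s}].
Proof.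
move=> chainC.
pose last (i : J * J) :=
  if [forall s in C, (i.2 \in d s) ==> (i.1 \in d s)] then i.2 else i.1.
exists (fun s => \sum_i (last i \in d s)%:Z); split.
- by apply: int_affine_sum => i _; apply: coding_form cod _.
- move=> s; apply: ler_sum => i _; rewrite /last.
  by case: ifP => _; case: (i.1 \in _); case: (i.2 \in _).
- move=> s Cs; apply: eq_bigr => i _; rewrite /last.
  case: ifP => [/forall_inP/(_ s Cs)/implyP imp|/forallPn[t]].
    by case: (i.2 \in d s) imp => [->|]; rewrite ?andbF.
  rewrite !negb_imply => /and3P[Ct t2 nt1].
  case/orP: (chain_comparable chainC Cs Ct) => /fintype.subsetP sub.
    by rewrite (contraNF (sub _) nt1).
  by rewrite (sub _ t2) andbT.
Qed.

(** [s0] starts the iterated meet: an empty meet would have to be coded by all of [J], which no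
    element of [A] need be. *)
Lemma meet_all W s0 : W \subset A -> s0 \in W ->
  exists2 m, m \in A & forall i, (i \in d m) = [forall s in W, i \in d s].
Proof.
move=> /fintype.subsetP WA Ws0.
have [m Am dm] : exists2 m, m \in A &
    forall i, (i \in d m) = (i \in d s0) && all (fun s => i \in d s) (enum W).
  have: {subset enum W <= A} by move=> s; rewrite mem_enum; apply: WA.
  elim: (enum W) => [_|s l IHl sub]; first by
    exists s0; rewrite ?WA //= => i; rewrite andbT.
  have [|m Am dm] := IHl; first by move=> t lt; apply: sub; rewrite inE lt orbT.
  have As : s \in A by apply: sub; rewrite inE eqxx.
  have [m' Am' dm'] := coding_meet cod As Am.
  by exists m' => // i; rewrite dm' inE dm /= andbCA.
exists m => // i; rewrite dm; apply/andP/forall_inP => [[_ /allP all_i] s Ws|all_i].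
  by apply: all_i; rewrite mem_enum.
by split; [apply: all_i | apply/allP => s; rewrite mem_enum; apply: all_i].
Qed.

Lemma join_all W s0 : W \subset A -> s0 \in W ->
  exists2 m, m \in A & forall i, (i \in d m) = [exists s in W, i \in d s].
Proof.
move=> /fintype.subsetP WA Ws0.
have [m Am dm] : exists2 m, m \in A &
    forall i, (i \in d m) = (i \in d s0) || has (fun s => i \in d s) (enum W).
  have: {subset enum W <= A} by move=> s; rewrite mem_enum; apply: WA.
  elim: (enum W) => [_|s l IHl sub]; first by
    exists s0; rewrite ?WA //= => i; rewrite orbF.
  have [|m Am dm] := IHl; first by move=> t lt; apply: sub; rewrite inE lt orbT.
  have As : s \in A by apply: sub; rewrite inE eqxx.
  have [m' Am' dm'] := coding_join cod As Am.
  by exists m' => // i; rewrite dm' inE dm /= orbCA.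
exists m => // i; rewrite dm; apply/orP/exists_inP => [[ds0|/hasP[s]]|[s Ws ds]].
- by exists s0.
- by rewrite mem_enum; exists s.
- by right; apply/hasP; exists s; rewrite ?mem_enum.
Qed.

Section Levels.
Variable R : realFieldType.
Implicit Types (x : J -> R) (w : R) (a b : 'S_n -> R).

(** The coordinate [j], in the order polytope, of the combination with weights [a]. *)
Definition weighted_sum a (j : J) : R := \sum_s a s * (j \in d s)%:R.

(** Call a subset [W] of [A] heavy if its weight is at least [t]. An index [j] lies in the level set
    exactly when the elements whose code contains [j] form a heavy set, so the level set is the
    union of the intersections of the codes over heavy sets, and these operations stay in the
    lattice. As [t] is positive, heavy sets are nonempty; as [t] is at most the total weight, [A]
    itself is heavy. *)
Lemma level_set_mem a (t : R) : (forall s, 0 <= a s) ->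
  (forall s, s \notin A -> a s = 0) -> 0 < t <= \sum_s a s ->
  exists2 s, s \in A & d s = [set j | t <= weighted_sum a j]%SET.
Proof.
move=> a_ge0 aA /andP[t_gt0 le_t].
have heavy_meet W : W \subset A -> t <= \sum_(s in W) a s ->
    exists2 m, m \in A & (forall i, (i \in d m) = [forall s in W, i \in d s]) /\
      d m \subset [set j | t <= weighted_sum a j]%SET.
  move=> WA tW; have [W0|/set0Pn[s0 Ws0]] := eqVneq W finset.set0.
    by move: tW; rewrite W0 big_set0 leNgt t_gt0.
  have [m Am dm] := meet_all WA Ws0; exists m => //; split=> //.
  apply/fintype.subsetP => i; rewrite dm inE => /forall_inP in_i.
  apply: le_trans tW _; rewrite big_mkcond; apply: ler_sum => s _.
  by case: ifP => [/in_i ->|_]; rewrite ?mulr1 // mulr_ge0 // ler0n.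
(* The join is taken over all elements coded inside the level set; the heavy meets are among them
   and already cover it. *)
pose W := [set m in A | d m \subset [set j | t <= weighted_sum a j]%SET]%SET.
have [m0 Am0 [_ dm0]] : exists2 m, m \in A &
    (forall i, (i \in d m) = [forall s in A, i \in d s]) /\
      d m \subset [set j | t <= weighted_sum a j]%SET.
  apply: heavy_meet => //; apply: le_trans le_t _; rewrite [leRHS]big_mkcond.
  by apply: ler_sum => s _; case: ifPn => // /aA ->.
have [||p Ap dp] := @join_all W m0.
- by apply/fintype.subsetP => s; rewrite inE => /andP[].
- by rewrite inE Am0.
exists p => //; apply/setP => j; rewrite dp.
apply/exists_inP/idP => [[s Ws js]|jG].
  by move: Ws; rewrite /W inE => /andP[_ /fintype.subsetP]; apply.
have [||m Am [dm subm]] := heavy_meet [set s in A | j \in d s]%SET.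
- by apply/fintype.subsetP => s; rewrite inE => /andP[].
- move: jG; rewrite inE => /le_trans; apply; rewrite [leRHS]big_mkcond.
  apply: ler_sum => s _; rewrite inE.
  have [As|/aA ->] := boolP (s \in A); last by rewrite mul0r.
  by case: (j \in d s); rewrite ?mulr1 ?mulr0.
exists m; first by rewrite inE Am.
by rewrite dm; apply/forall_inP => s; rewrite inE => /andP[].
Qed.

(** Induct on the number of positive coordinates. The least positive value [t] has the whole support
    of [x] as its level set, coded by some [s0]; give [s0] the weight [t] and subtract [t] from the
    positive coordinates and from [w]. All later codes lie in the support, so [s0] is the top of the
    resulting chain. When no coordinate is positive, the remaining weight goes to the element coded
    by the empty set. *)
Lemma level_decomposition x w : (forall j, 0 <= x j <= w) -> 0 <= w ->
  (forall t : R, 0 < t <= w -> exists2 s, s \in A & d s = [set j | t <= x j]%SET) ->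
  exists b C, [/\ chain_in le A C,
    {in C, forall s, d s \subset [set j | 0 < x j]%SET},
    forall s, 0 <= b s /\ (s \notin C -> b s = 0),
    \sum_s b s = w & weighted_sum b =1 x].
Proof.
have [k] := ubnP #|[set j | 0 < x j]%SET|.
elim: k x w => // k IHk x w ltk xw w_ge0 levels.
have [w0|w_neq0] := eqVneq w 0.
  exists (fun=> 0), finset.set0; split.
  - by rewrite /chain_in finset.sub0set; apply/forall_inP => s; rewrite inE.
  - by move=> s; rewrite inE.
  - by [].
  - by rewrite big1.
  - move=> j; rewrite /weighted_sum big1 => [|s _]; last by rewrite mul0r.
    by apply/esym/eqP; rewrite eq_le andbC -{2}w0.
have w_gt0 : 0 < w by rewrite lt_neqAle eq_sym w_neq0.
have [x0|/set0Pn[j1 xj1]] := eqVneq [set j | 0 < x j]%SET finset.set0.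
  have [|s As ds] := levels w; first by rewrite w_gt0 lexx.
  have xE j : x j = 0.
    apply/eqP; rewrite eq_le; case/andP: (xw j) => -> _; rewrite andbT leNgt.
    by have := finset.in_set0 j; rewrite -x0 inE => ->.
  have ds0 : d s = finset.set0.
    by apply/setP => j; rewrite ds !inE xE leNgt w_gt0.
  exists (fun t => if t == s then w else 0), [set s]%SET; split.
  - rewrite /chain_in finset.sub1set As; apply/forall_inP => t /set1P->.
    by apply/forall_inP => u /set1P->; rewrite (coding_le cod) ?subxx.
  - by move=> t /set1P->; rewrite ds0 finset.sub0set.
  - by move=> t; rewrite inE; case: eqP.
  - by rewrite -big_mkcond big_pred1_eq.
  - move=> j; rewrite xE /weighted_sum big1 // => t _.
    by case: eqP => [->|_]; rewrite ?ds0 ?inE ?mul0r ?mulr0.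
have [j0 xj0 min_j0] : exists2 j0, 0 < x j0 & forall j, 0 < x j -> x j0 <= x j.
  move: xj1; rewrite inE => xj1.
  by case: (@arg_minP _ R J j1 (fun j => 0 < x j) x) => // j0; exists j0.
pose t := x j0; pose x' j := if 0 < x j then x j - t else 0.
have x_pos j : (0 < x j) = (t <= x j).
  by apply/idP/idP => [/min_j0|]; [|apply: lt_le_trans].
have xNpos j : (0 < x j) = false -> x j = 0.
  by move=> xj; apply/eqP; rewrite eq_le leNgt xj /=; case/andP: (xw j).
have t_le : t <= w by case/andP: (xw j0).
have [|s0 As0 ds0] := levels t; first by rewrite xj0.
have pos'_sub : [set j | 0 < x' j]%SET \subset [set j | 0 < x j]%SET.
  by apply/fintype.subsetP => j; rewrite !inE /x'; case: ifP => //; rewrite ltxx.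
have [||||b [C [chainC subC b_ge0 sum_b wsum_b]]] := IHk x' (w - t).
- rewrite -ltnS; apply: leq_trans ltk; rewrite ltnS; apply: proper_card.
  rewrite properE pos'_sub; apply/subsetPn; exists j0; rewrite !inE //.
  by rewrite /x' xj0 subrr ltxx.
- move=> j; rewrite /x'; case: ifP => [|_]; last by rewrite lexx subr_ge0.
  by rewrite x_pos subr_ge0 => ->; rewrite lerB //; case/andP: (xw j).
- by rewrite subr_ge0.
(* For positive [u], the level set of [x'] at [u] is that of [x] at [t + u]. *)
- move=> u /andP[u_gt0 le_u]; have [|s As ds] := levels (t + u).
    by rewrite addr_gt0 // -lerBrDl.
  exists s => //; rewrite ds; apply/setP => j; rewrite !inE /x'; case: ifP => xj.
    by rewrite lerBrDl.
  by rewrite (xNpos _ xj) !leNgt u_gt0 addr_gt0.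
have ds0E : d s0 = [set j | 0 < x j]%SET.
  by rewrite ds0; apply/setP => j; rewrite !inE x_pos.
exists (fun s => b s + if s == s0 then t else 0), (s0 |: C)%SET; split.
- case/andP: (chainC) => /fintype.subsetP CA /forall_inP cmpC.
  have below s : s \in C -> le s s0.
    by move=> Cs; rewrite (coding_le cod (CA _ Cs) As0) ds0E (fintype.subset_trans (subC s Cs)).
  apply/andP; split; first by rewrite finset.subUset finset.sub1set As0; apply/fintype.subsetP.
  apply/forall_inP => s; rewrite !inE => /predU1P[->|Cs];
    apply/forall_inP => u; rewrite !inE => /predU1P[->|Cu].
  + by rewrite (coding_le cod) ?subxx.
  + by rewrite below ?orbT.
  + by rewrite below.
  + by have /forall_inP/(_ u Cu) := cmpC s Cs.
- move=> s; rewrite !inE => /predU1P[->|/subC]; first by rewrite ds0E.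
  by move/fintype.subset_trans; apply.
- move=> s; have [b0 bC] := b_ge0 s; split.
    by rewrite addr_ge0 //; case: ifP => // _; apply: ltW.
  rewrite !inE negb_or => /andP[/negPf-> /bC->]; exact: addr0.
- by rewrite big_split /= sum_b -big_mkcond big_pred1_eq subrK.
- move=> j; rewrite /weighted_sum.
  under eq_bigr => s _ do rewrite mulrDl.
  rewrite big_split /= -/(weighted_sum b j) wsum_b (bigD1 s0) //= eqxx.
  rewrite big1 ?addr0 => [|s /negPf->]; last by rewrite mul0r.
  rewrite ds0E inE /x'; case: ifP => [_|/xNpos->]; rewrite ?mulr1 ?subrK //.
  by rewrite mulr0 addr0.
Qed.

Lemma chain_decomposition a : (forall s, 0 <= a s) ->
  (forall s, s \notin A -> a s = 0) ->
  exists b C, [/\ chain_in le A C,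
    forall s, 0 <= b s /\ (s \notin C -> b s = 0),
    \sum_s b s = \sum_s a s &
    forall r c, \sum_s b s * (s r == c)%:R = \sum_s a s * (s r == c)%:R].
Proof.
move=> a_ge0 aA.
have [|||b [C [chainC _ b_ge0 sum_b wsum_b]]] :=
  @level_decomposition (weighted_sum a) (\sum_s a s).
- move=> j; rewrite sumr_ge0 => [|s _]; last by rewrite mulr_ge0 ?ler0n.
  by apply: ler_sum => s _; case: (j \in d s); rewrite ?mulr1 ?mulr0.
- exact: sumr_ge0.
- by move=> t; apply: level_set_mem.
exists b, C; split=> // r c.
have [u0 [u uE]] := coding_entry cod r c.
have entry_sum f : (forall s, s \notin A -> f s = 0) ->
    \sum_s f s * (s r == c)%:R =
    u0%:~R * (\sum_s f s) + \sum_j (u j)%:~R * weighted_sum f j :> R.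
  move=> fA; transitivity (\sum_s f s * (u0%:~R + \sum_j (u j)%:~R * (j \in d s)%:R)).
    apply: eq_bigr => s _; have [As|/fA ->] := boolP (s \in A); last by rewrite !mul0r.
    congr (_ * _); have /(congr1 (fun z : int => z%:~R : R)) := uE s As.
    rewrite rmorphD rmorph_sum /= -pmulrn => ->; congr (_ + _).
    by apply: eq_bigr => j _; rewrite rmorphM.
  under eq_bigr => s _ do rewrite mulrDr mulrC mulr_sumr.
  rewrite big_split /= mulr_sumr exchange_big; congr (_ + _).
  apply: eq_bigr => j _; rewrite mulr_sumr; apply: eq_bigr => s _.
  by rewrite mulrCA.
rewrite !entry_sum //; last first.
  by move=> s nAs; apply: (b_ge0 s).2; apply: contra nAs; apply: chain_mem.
by rewrite sum_b; congr (_ + _); apply: eq_bigr => j _; rewrite wsum_b.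
Qed.

End Levels.
End Coding.

(** * Convex hulls of permutation matrices *)

Section EntryForm.
Variables (R : realFieldType) (n : nat).

Definition entry_form (Z : 'M[int]_n) (x : 'M[R]_n) : R :=
  \sum_r \sum_c (Z r c)%:~R * x r c.

Lemma entry_form_is_linear Z : linear_for *%R (entry_form Z).
Proof.
move=> a x y; rewrite /entry_form mulr_sumr -big_split /=.
apply: eq_bigr => r _; rewrite mulr_sumr -big_split /=.
by apply: eq_bigr => c _; rewrite !mxE mulrDr mulrCA.
Qed.

HB.instance Definition _ Z := GRing.isLinear.Build R 'M[R]_n R *%R
  (entry_form Z) (entry_form_is_linear Z).

Lemma entry_form_perm Z (s : 'S_n) :
  entry_form Z (perm_mx s) = (\sum_r Z r (s r))%:~R.
Proof.
rewrite rmorph_sum; apply: eq_bigr => r _; rewrite (bigD1 (s r)) //= !mxE eqxx.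
rewrite mulr1 big1 ?addr0 // => c /negPf; rewrite !mxE eq_sym => ->.
exact: mulr0.
Qed.

Lemma entry_form_int Z X : integer_points X -> exists y : int, entry_form Z X = y%:~R.
Proof.
case=> Y _ <-; exists (\sum_r \sum_c Z r c * Y r c).
rewrite rmorph_sum; apply: eq_bigr => r _; rewrite rmorph_sum.
by apply: eq_bigr => c _; rewrite mxE rmorphM.
Qed.

Lemma int_affine_form C f : int_affine C f ->
  exists (z : int) (Z : 'M[int]_n), {in C, forall s : 'S_n,
    (f s)%:~R = z%:~R + entry_form Z (perm_mx s)}.
Proof.
move=> [z [Z fE]]; exists z, Z => s Cs.
by rewrite fE // rmorphD /= entry_form_perm.
Qed.

End EntryForm.

Section PermHull.
Variables (R : realFieldType) (n : nat).
Local Notation M := (@perm_mx R n).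
Local Notation points := (@perm_points R n).
Implicit Types (s t : 'S_n) (C : {set 'S_n}) (a b : 'S_n -> R).

Lemma perm_mx_inj : injective M.
Proof.
move=> s t /matrixP eq_st; apply/permP => r; have := eq_st r (s r).
rewrite !mxE eqxx; case: eqP => // _ /eqP; by rewrite oner_eq0.
Qed.

Lemma perm_pointsE C s : points C (M s) <-> s \in C.
Proof. by split=> [[t Ct /perm_mx_inj <-]|Cs] //; exists s. Qed.

Lemma perm_points_inj C C' : points C = points C' -> C = C'.
Proof.
move=> eqC; apply/setP => s; apply/idP/idP => /perm_pointsE;
  by rewrite (eqC, =^~ eqC) => /perm_pointsE.
Qed.

(** Turns an indexed combination, possibly with repeated points, into one weight per permutation.
    Quantifying over [G] lets the same weight carry the matrix, its lifted height, or an indicator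
    function. *)
Lemma perm_points_gather C k (v : 'I_k -> 'M[R]_n) (c : 'I_k -> R) :
  (forall i, points C (v i)) -> exists a,
  [/\ (forall i, 0 <= c i) -> forall s, 0 <= a s,
    forall s, s \notin C -> a s = 0, \sum_s a s = \sum_i c i &
    forall (W : lmodType R) (G : 'M[R]_n -> W),
      \sum_s a s *: G (M s) = \sum_i c i *: G (v i)].
Proof.
move=> /fin_all_exists2[g Cg gE].
exists (fun s => \sum_(i | g i == s) c i); split.
- by move=> c_ge0 s; apply: sumr_ge0.
- move=> s nCs; rewrite big1 // => i /eqP gi; case/negP: nCs; rewrite -gi.
  exact: Cg.
- by rewrite [RHS](partition_big g xpredT).
- move=> W G; rewrite [RHS](partition_big g xpredT) //=; apply: eq_bigr => s _.
  by rewrite scaler_suml; apply: eq_bigr => i /eqP <-; rewrite gE.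
Qed.

Lemma sum_supported (W : nmodType) C (F : 'S_n -> W) :
  (forall s, s \notin C -> F s = 0) ->
  \sum_s F s = \sum_(i < #|C|) F (enum_val i).
Proof.
move=> FC; rewrite -(big_enum_val (A := mem C)) [RHS]big_mkcond; apply: eq_bigr => s _.
by case: ifPn => // /FC.
Qed.

Lemma perm_hullP C x : convex_hull (points C) x <->
  exists a, [/\ forall s, 0 <= a s, forall s, s \notin C -> a s = 0,
    \sum_s a s = 1 & x = \sum_s a s *: M s].
Proof.
split=> [[k [v [c [vC c_ge0 sum_c ->]]]]|[a [a_ge0 aC sum_a ->]]].
  have [a [a_ge0 aC sum_a GE]] := perm_points_gather c vC.
  by exists a; split=> //; [apply: a_ge0 | rewrite sum_a | rewrite (GE _ id)].
exists #|C|, (fun i => M (enum_val i)), (fun i => a (enum_val i)); split=> //.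
- by move=> i; apply/perm_pointsE/enum_valP.
- by rewrite -sum_a (sum_supported aC).
- by rewrite (@sum_supported _ C) // => s /aC ->; rewrite scale0r.
Qed.

Lemma perm_hull_point C s : s \in C -> convex_hull (points C) (M s).
Proof.
move=> Cs; apply/perm_hullP; exists (fun t => (t == s)%:R); split.
- by move=> t; rewrite ler0n.
- by move=> t; case: eqP => // -> /negP.
- by rewrite (bigD1 s) //= eqxx big1 ?addr0 // => t /negPf ->.
- by rewrite (bigD1 s) //= eqxx scale1r big1 ?addr0 // => t /negPf ->; rewrite scale0r.
Qed.

Lemma perm_hullS C C' : C \subset C' ->
  convex_hull (points C) `<=` convex_hull (points C').
Proof.
move=> /fintype.subsetP CC' x /perm_hullP[a [a_ge0 aC sum_a ->]].
apply/perm_hullP; exists a; split=> // s nC's; apply: aC.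
by apply: contra nC's; apply: CC'.
Qed.

Lemma int_affine_sum_form C f z Z a :
  {in C, forall s, (f s)%:~R = z%:~R + entry_form Z (M s)} ->
  (forall s, s \notin C -> a s = 0) ->
  \sum_s a s * (f s)%:~R =
    (\sum_s a s) * z%:~R + entry_form Z (\sum_s a s *: M s).
Proof.
move=> fE aC; rewrite linear_sum mulr_suml -big_split /=; apply: eq_bigr => s _.
have [Cs|/aC ->] := boolP (s \in C); last by rewrite scale0r linear0 !mul0r addr0.
by rewrite fE // mulrDr linearZ.
Qed.

(** Complementary slackness: when a supporting function is tight at a point, it is tight at every
    permutation that carries weight there. *)
Lemma sum_eq0_support (F : 'S_n -> R) (a : 'S_n -> R) : (forall s, 0 <= a s) ->
  (forall s, a s != 0 -> 0 <= F s) -> \sum_s a s * F s = 0 ->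
  forall s, a s != 0 -> F s = 0.
Proof.
move=> a_ge0 F_ge0 sum0 s as0; apply/eqP.
have /psumr_eq0P/(_ sum0 s isT)/eqP : forall t, true -> 0 <= a t * F t.
  move=> t _; have [->|at0] := eqVneq (a t) 0; first by rewrite mul0r.
  by rewrite mulr_ge0 // F_ge0.
by rewrite mulf_eq0 (negPf as0).
Qed.

Lemma perm_hull_face C F : is_face (convex_hull (points C)) F ->
  exists2 C' : {set 'S_n}, C' \subset C & F = convex_hull (points C').
Proof.
move=> [l [c [l_le ->]]]; exists [set s in C | l (M s) == c]%SET.
  by apply/fintype.subsetP => s; rewrite inE => /andP[].
apply/seteqP; split=> x.
  move=> [/perm_hullP[a [a_ge0 aC sum_a xE]] /= lx]; apply/perm_hullP.
  exists a; split=> // s nC's; apply: contraTeq isT => as0.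
  have Cs : s \in C by apply: contraNT as0 => /aC ->.
  have /eqP : c - l (M s) = 0.
    apply: (@sum_eq0_support (fun s => c - l (M s)) a) => // [t at0|].
      rewrite subr_ge0 l_le //; apply: perm_hull_point.
      by apply: contraNT at0 => /aC ->.
    under eq_bigr => t _ do rewrite mulrBr.
    rewrite sumrB -mulr_suml sum_a mul1r -lx xE linear_sum.
    by apply/eqP; rewrite subr_eq0; apply/eqP/eq_bigr => t _; rewrite linearZ.
  by rewrite subr_eq0 eq_sym => ls; move: nC's; rewrite inE Cs ls.
move=> /perm_hullP[a [a_ge0 aC' sum_a xE]]; split.
  apply/perm_hullP; exists a; split=> // s nCs; apply: aC'.
  by apply: contra nCs; rewrite inE => /andP[].
rewrite /= xE linear_sum /= -[c]mul1r -sum_a mulr_suml; apply: eq_bigr => s _.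
rewrite linearZ /=; have [|/aC' ->] := boolP (s \in [set s in C | l (M s) == c]%SET).
  by rewrite inE => /andP[_ /eqP->].
by rewrite !mul0r.
Qed.

Lemma int_affine_face C C' f : int_affine C f ->
  {in C, forall s, f s <= 0} -> C' = [set s in C | f s == 0]%SET ->
  is_face (convex_hull (points C)) (convex_hull (points C')).
Proof.
move=> /(int_affine_form R)[z [Z fE]] f_le0 ->.
exists (entry_form Z), (- z%:~R).
have sumE a : (forall s, s \notin C -> a s = 0) -> \sum_s a s = 1 ->
    \sum_s a s * (f s)%:~R = z%:~R + entry_form Z (\sum_s a s *: M s).
  by move=> aC sum_a; rewrite (int_affine_sum_form fE aC) sum_a mul1r.
split=> [x /perm_hullP[a [a_ge0 aC sum_a ->]]|].
  rewrite -subr_ge0 -opprD -sumE // -sumrN sumr_ge0 // => s _.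
  have [Cs|/aC->] := boolP (s \in C); last by rewrite mul0r oppr0.
  by rewrite -mulrN mulr_ge0 // oppr_ge0 lerz0 f_le0.
apply/seteqP; split=> x.
  move=> /perm_hullP[a [a_ge0 aC' sum_a ->]].
  have aC s : s \notin C -> a s = 0.
    by move=> nCs; apply: aC'; apply: contra nCs; rewrite inE => /andP[].
  split; first by apply/perm_hullP; exists a.
  apply/eqP; rewrite /= -addr_eq0 addrC -sumE // big1 // => s _.
  have [|/aC' ->] := boolP (s \in [set s in C | f s == 0]%SET).
    by rewrite inE => /andP[_ /eqP->]; rewrite mulr0.
  by rewrite mul0r.
move=> [/perm_hullP[a [a_ge0 aC sum_a ->]]] /= lx.
apply/perm_hullP; exists a; split=> // s; apply: contraNeq => as0.
have Csupp t : a t != 0 -> t \in C by apply: contraNT => /aC ->.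
have /eqP : - (f s)%:~R = 0 :> R.
  apply: (@sum_eq0_support (fun s => - (f s)%:~R) a) => // [t at0|].
    by rewrite oppr_ge0 lerz0 f_le0 // Csupp.
  under eq_bigr => t _ do rewrite mulrN.
  by rewrite sumrN sumE // lx subrr oppr0.
by rewrite oppr_eq0 intr_eq0 inE Csupp.
Qed.

Lemma convex_hull1 s : convex_hull (points [set s]%SET) = [set M s].
Proof.
apply/seteqP; split=> x.
  move=> /perm_hullP[a [_ aC sum_a ->]] /=.
  have a0 t : t != s -> a t = 0 by move=> ts; apply: aC; rewrite inE.
  rewrite (bigD1 s) //= big1 => [|t /a0 ->]; last by rewrite scale0r.
  by move: sum_a; rewrite (bigD1 s) //= big1 // !addr0 => ->; rewrite scale1r.
by move=> ->; apply: perm_hull_point; rewrite inE.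
Qed.

(** The function counts the positions where [t] agrees with [s], minus [n]. It exposes the matrix of
    [s] as a vertex of any hull of permutation matrices containing it. *)
Lemma exposing_form C s : exists f,
  [/\ int_affine C f, forall t, f t <= 0 & forall t, (f t == 0) = (t == s)].
Proof.
exists (fun t => \sum_r ((t r == s r)%:Z - 1)); split.
- apply: int_affine_sum => r _; apply: int_affineB.
    exact: int_affine_entry.
  exact: int_affine_cst.
- by move=> t; apply: sumr_le0 => r _; case: (_ == _).
move=> t; apply/eqP/eqP => [sum0|->]; last first.
  by rewrite big1 // => r _; rewrite eqxx subrr.
apply/permP => r; apply/eqP; move/eqP: sum0; rewrite -oppr_eq0 -sumrN => /eqP.
have /psumr_eq0P H : forall i, true -> 0 <= - ((t i == s i)%:Z - 1) :> int.
  by move=> i _; case: (_ == _).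
by move=> /H/(_ r isT); case: (t r == s r).
Qed.

Lemma perm_hull_mem C s : convex_hull (points C) (M s) -> s \in C.
Proof.
have [f [/(int_affine_form R)[z [Z fE]] f_le0 f0]] := exposing_form [set: 'S_n] s.
move=> /perm_hullP[a [a_ge0 aC sum_a sE]]; apply: contraT => nCs.
have sum_f : \sum_t a t * - (f t)%:~R = 0.
  under eq_bigr => t _ do rewrite mulrN.
  rewrite sumrN (int_affine_sum_form fE) => [|t]; last by rewrite inE.
  by rewrite sum_a mul1r -sE -fE ?inE // (eqP (_ : f s == 0)) ?oppr0 // f0.
have a0 t : a t = 0.
  apply/eqP; apply: contraT => at0.
  have /eqP : - (f t)%:~R = 0 :> R.
    by apply: (sum_eq0_support a_ge0) sum_f _ at0 => u _; rewrite oppr_ge0 lerz0.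
  rewrite oppr_eq0 intr_eq0 f0 => /eqP ts; move: at0.
  by rewrite ts aC ?eqxx.
by move/eqP: sum_a; rewrite big1 // eq_sym oner_eq0.
Qed.

Lemma vertices_perm_hull C : vertices (convex_hull (points C)) = points C.
Proof.
apply/seteqP; split=> x.
  move=> /perm_hull_face[C' /fintype.subsetP CC' eqF].
  have : convex_hull (points C') x by rewrite -eqF.
  have [->|/set0Pn[s C's] _] := eqVneq C' finset.set0.
    move=> /perm_hullP[a [_ a0 + _]]; rewrite big1 => [/eqP|s _].
      by rewrite eq_sym oner_eq0.
    by rewrite a0 // inE.
  have := perm_hull_point C's; rewrite -eqF => /= <-.
  by apply/perm_pointsE/CC'.
case=> s Cs <-; rewrite /vertices /= -convex_hull1.
have [f [aff_f f_le0 f0]] := exposing_form C s.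
apply: (int_affine_face aff_f) => //; apply/setP => t; rewrite !inE f0.
by case: eqP => [->|]; rewrite ?andbT ?andbF.
Qed.

End PermHull.

(** * The triangulation by chains *)

Section CodedTriangulation.
Variables (R : realFieldType) (n : nat) (J : finType) (le : rel 'S_n).
Variables (A : {set 'S_n}) (d : 'S_n -> {set J}).
Hypothesis cod : order_coding le A d.
Local Notation M := (@perm_mx R n).
Local Notation points := (@perm_points R n).
Local Notation cell C := (convex_hull (points C)).
Local Notation cells := (@chain_cells R n le A).
Local Notation polytope := (@perm_polytope R n A).
Local Notation hgt := (height d).
Implicit Types (s t : 'S_n) (C : {set 'S_n}) (a b : 'S_n -> R).

Lemma chain_inS C C' : C' \subset C -> chain_in le A C -> chain_in le A C'.
Proof.
move=> /fintype.subsetP C'C /andP[/fintype.subsetP CA /forall_inP cmpC].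
apply/andP; split; first by apply/fintype.subsetP => s /C'C/CA.
apply/forall_inP => s /C'C Cs; apply/forall_inP => t /C'C.
exact: (forall_inP (cmpC s Cs)).
Qed.

(** Kept homogeneous in the total weight so as to serve twice: total 0 gives affine independence,
    total 1 gives integral barycentric coordinates. *)
Lemma chain_coefficients C a : chain_in le A C -> (forall s, s \notin C -> a s = 0) ->
  forall s, s \in C -> exists (z : int) (Z : 'M[int]_n),
  a s = (\sum_t a t) * z%:~R + entry_form Z (\sum_t a t *: M t).
Proof.
move=> chainC aC s Cs.
have [z [Z fE]] := int_affine_form R (chain_coordinate cod chainC Cs).
exists z, Z; rewrite -(int_affine_sum_form fE aC) (bigD1 s) //= eqxx mulr1.
by rewrite big1 ?addr0 // => t /negPf ->; rewrite mulr0.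
Qed.

Lemma chain_independent C a : chain_in le A C ->
  (forall s, s \notin C -> a s = 0) -> \sum_s a s = 0 ->
  \sum_s a s *: M s = 0 -> forall s, a s = 0.
Proof.
move=> chainC aC sum_a sum_aM s; have [Cs|/aC//] := boolP (s \in C).
have [z [Z ->]] := chain_coefficients chainC aC Cs.
by rewrite sum_a sum_aM linear0 mul0r addr0.
Qed.

Lemma chain_cell_simplex C : chain_in le A C -> is_simplex (cell C).
Proof.
move=> chainC; exists #|C|, (fun i => M (enum_val i)); split.
  move=> c sum_c sum_cM i.
  have [|a [_ aC sum_a sum_aM]] :=
    @perm_points_gather R n C _ (fun i => M (enum_val i)) c.
    by move=> j; apply/perm_pointsE/enum_valP.
  have a0 := chain_independent chainC aC (etrans sum_a sum_c)
    (etrans (sum_aM _ id) sum_cM).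
  (* Taking for [G] the indicator of the vertex number [i] isolates the coefficient [c i]. *)
  have := sum_aM R^o (fun x => (x == M (enum_val i))%:R).
  rewrite big1 => [|s _]; last by rewrite a0 scale0r.
  rewrite (bigD1 i) //= eqxx big1 ?addr0 => [|j ji].
    by rewrite /GRing.scale /= mulr1.
  by rewrite (inj_eq (@perm_mx_inj R n)) (inj_eq enum_val_inj) (negPf ji) scaler0.
congr convex_hull; apply/seteqP; split=> x; last first.
  by case=> i _ <-; apply/perm_pointsE/enum_valP.
by case=> s Cs <-; exists (enum_rank_in Cs s) => //; rewrite enum_rankK_in.
Qed.

(** The supporting function is minus the sum of the barycentric coordinates at the vertices outside
    [C']. *)
Lemma chain_subface C C' : chain_in le A C -> C' \subset C ->
  is_face (cell C) (cell C').
Proof.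
move=> chainC /fintype.subsetP C'C.
have coordE s : s \in C -> \sum_(t in C :\: C') - (s == t)%:Z = - (s \notin C')%:Z.
  move=> Cs; rewrite sumrN; congr (- _); rewrite big_mkcond (bigD1 s) //= big1.
    by rewrite inE Cs eqxx andbT addr0; case: (s \in C').
  by move=> t; rewrite eq_sym => /negPf ->; case: ifP.
apply: (@int_affine_face _ _ _ _ (fun s => \sum_(t in C :\: C') - (s == t)%:Z)).
- apply: int_affine_sum => t; rewrite inE => /andP[_ Ct]; apply: int_affineN.
  exact: (chain_coordinate cod chainC Ct).
- by move=> s Cs; rewrite coordE // oppr_le0.
apply/setP => s; rewrite inE; have [Cs|nCs] := boolP (s \in C).
  by rewrite coordE // oppr_eq0; case: (s \in C').
by apply: contraNF nCs; apply: C'C.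
Qed.

(** If [s] and [t] were tight and incomparable, their heights would add up to [f] at the meet plus
    [f] at the join, hence to at least the heights there, against strict supermodularity. *)
Lemma tight_chain f : int_affine A f -> {in A, forall s, hgt s <= f s} ->
  chain_in le A [set s in A | hgt s == f s]%SET.
Proof.
move=> aff_f hf; apply/andP; split.
  by apply/fintype.subsetP => s; rewrite inE => /andP[].
apply/forall_inP => s; rewrite inE => /andP[As /eqP fs].
apply/forall_inP => t; rewrite inE => /andP[At /eqP ft].
rewrite !(coding_le cod) //; apply: contraT; rewrite negb_or => /andP[nst nts].
have [m Am dm] := coding_meet cod As At.
have [p Ap dp] := coding_join cod As At.
have := height_supermodular dm dp nst nts.
rewrite fs ft (meet_join_int_affine cod As At Am Ap dm dp aff_f).
by rewrite ltNge lerD ?hf.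
Qed.

Lemma supporting_chain C : chain_in le A C -> exists f,
  [/\ int_affine A f, forall s, hgt s <= f s, {in C, forall s, hgt s = f s},
    C \subset [set s in A | hgt s == f s]%SET &
    chain_in le A [set s in A | hgt s == f s]%SET].
Proof.
move=> chainC; have [f [aff_f hf Cf]] := chain_support cod chainC.
exists f; split=> //; last by apply: tight_chain.
by apply/fintype.subsetP => s Cs; rewrite inE (chain_mem chainC) // Cf /=.
Qed.

Lemma int_affine_eq_sum f a b : int_affine A f ->
  (forall s, s \notin A -> a s = 0) -> (forall s, s \notin A -> b s = 0) ->
  \sum_s a s = \sum_s b s -> \sum_s a s *: M s = \sum_s b s *: M s ->
  \sum_s a s * (f s)%:~R = \sum_s b s * (f s)%:~R.
Proof.
move=> /(int_affine_form R)[z [Z fE]] aA bA sum_ab sum_abM.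
by rewrite (int_affine_sum_form fE aA) (int_affine_sum_form fE bA) sum_ab sum_abM.
Qed.

Lemma support_notin C a : C \subset A -> (forall s, s \notin C -> a s = 0) ->
  forall s, s \notin A -> a s = 0.
Proof.
move=> /fintype.subsetP CA aC s nAs; apply: aC; apply: contra nAs; exact: CA.
Qed.

(** With [f] supporting on [C], the height sum for [a] equals the [f] sum for [a], hence the [f] sum
    for [b], which dominates the height sum for [b]. Thus chains minimise the lifting, which is the
    negated height. *)
Lemma chain_height_min C a b : chain_in le A C -> (forall s, 0 <= b s) ->
  (forall s, s \notin C -> a s = 0) -> (forall s, s \notin A -> b s = 0) ->
  \sum_s a s = \sum_s b s -> \sum_s a s *: M s = \sum_s b s *: M s ->
  \sum_s b s * (hgt s)%:~R <= \sum_s a s * (hgt s)%:~R.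
Proof.
move=> chainC b_ge0 aC bA sum_ab sum_abM.
have [f [aff_f hf Cf _ _]] := supporting_chain chainC.
have -> : \sum_s a s * (hgt s)%:~R = \sum_s a s * (f s)%:~R.
  apply: eq_bigr => s _; have [/Cf ->//|/aC ->] := boolP (s \in C).
  by rewrite !mul0r.
rewrite (int_affine_eq_sum aff_f (support_notin _ aC) bA sum_ab) ?(chain_sub chainC) //.
by apply: ler_sum => s _; rewrite ler_wpM2l ?ler_int.
Qed.

(** By minimality both decompositions have the same total height, so [b] is carried by the set where
    the supporting function of [C1] is tight. That set is a chain containing [C1], and points of a
    chain are affinely independent. *)
Lemma chain_decomposition_unique C1 C2 a b :
  chain_in le A C1 -> chain_in le A C2 ->
  (forall s, 0 <= a s) -> (forall s, 0 <= b s) ->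
  (forall s, s \notin C1 -> a s = 0) -> (forall s, s \notin C2 -> b s = 0) ->
  \sum_s a s = \sum_s b s -> \sum_s a s *: M s = \sum_s b s *: M s ->
  forall s, a s = b s.
Proof.
move=> chain1 chain2 a_ge0 b_ge0 aC bC sum_ab sum_abM s.
have aA := support_notin (chain_sub chain1) aC.
have bA := support_notin (chain_sub chain2) bC.
have [f [aff_f hf Cf /fintype.subsetP subW chainW]] := supporting_chain chain1.
have sum_h : \sum_s a s * (hgt s)%:~R = \sum_s b s * (hgt s)%:~R.
  apply/eqP; rewrite eq_le (chain_height_min chain2) ?(chain_height_min chain1) //.
have bW t : b t != 0 -> hgt t = f t.
  move=> bt0; apply/eqP; rewrite eq_sym -subr_eq0 -(intr_eq0 R) rmorphB; apply/eqP.
  apply: (@sum_eq0_support R n (fun u => (f u)%:~R - (hgt u)%:~R) b b_ge0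
    _ _ t bt0) => [u _|]; first by rewrite subr_ge0 ler_int.
  under eq_bigr => u _ do rewrite mulrBr.
  rewrite sumrB -sum_h -(int_affine_eq_sum aff_f aA bA sum_ab sum_abM) -sumrB.
  apply: big1 => u _; have [/Cf ->|/aC ->] := boolP (u \in C1); first exact: subrr.
  by rewrite !mul0r subrr.
apply/eqP; rewrite -subr_eq0; apply/eqP; move: s.
apply: (chain_independent chainW).
- move=> s nWs; have -> : a s = 0 by apply: aC; apply: contra nWs; apply: subW.
  have [->|bs0] := eqVneq (b s) 0; first exact: subrr.
  move: nWs; rewrite inE bW // eqxx andbT => /bA ->; exact: subrr.
- by rewrite sumrB sum_ab subrr.
- under eq_bigr => t _ do rewrite scalerBl.
  by rewrite sumrB sum_abM subrr.
Qed.

Lemma chain_cell_setI C1 C2 : chain_in le A C1 -> chain_in le A C2 ->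
  cell C1 `&` cell C2 = cell (C1 :&: C2)%SET.
Proof.
move=> chain1 chain2; apply/seteqP; split=> x; last first.
  by move=> Cx; split; move: x Cx; apply: perm_hullS;
    [apply: finset.subsetIl | apply: finset.subsetIr].
case=> /perm_hullP[a [a_ge0 aC sum_a ->]] /perm_hullP[b [b_ge0 bC sum_b eq_ab]].
have ab := chain_decomposition_unique chain1 chain2 a_ge0 b_ge0 aC bC
  (etrans sum_a (esym sum_b)) eq_ab.
apply/perm_hullP; exists a; split=> // s; rewrite inE negb_and => /orP[/aC//|].
by rewrite ab => /bC.
Qed.

Lemma chain_cells_cover : \bigcup_(S in cells) S = polytope.
Proof.
apply/seteqP; split=> x.
  by move=> [_ [C chainC <-]]; apply: perm_hullS; apply: (chain_sub chainC).
move=> /perm_hullP[a [a_ge0 aA sum_a xE]].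
have [b [C [chainC b_ge0C sum_b entries]]] := chain_decomposition cod a_ge0 aA.
exists (cell C); first by exists C.
apply/perm_hullP; exists b; split=> [s|s||]; try exact: (b_ge0C s).1.
- exact: (b_ge0C s).2.
- by rewrite sum_b.
have entryE (c : 'S_n -> R) r i :
    (\sum_s c s *: M s) r i = \sum_s c s * (s r == i)%:R.
  by rewrite summxE; apply: eq_bigr => s _; rewrite !mxE.
by rewrite xE; apply/matrixP => r i; rewrite !entryE.
Qed.

Theorem coded_triangulation : triangulation polytope cells.
Proof.
split.
- by apply: finite_image; apply: finite_finset.
- by move=> _ [C chainC <-]; apply: chain_cell_simplex.
- move=> _ F [C chainC <-] /perm_hull_face[C' C'C ->]; exists C' => //.
  exact: chain_inS chainC.
- move=> _ _ [C1 chain1 <-] [C2 chain2 <-]; rewrite chain_cell_setI //.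
  by split; apply: chain_subface; rewrite ?finset.subsetIl ?finset.subsetIr.
- exact: chain_cells_cover.
Qed.

Lemma chain_complexP X : abstract_complex cells X <->
  exists2 C : {set 'S_n}, chain_in le A C & X = points C.
Proof.
split=> [[_ [C chainC <-] <-]|[C chainC ->]].
  by exists C; rewrite ?vertices_perm_hull.
by exists (cell C); [exists C | rewrite vertices_perm_hull].
Qed.

(** A nonface made of vertices contains an incomparable pair; this pair is already a nonface, so
    minimality leaves nothing else. *)
Theorem coded_flag : flag cells.
Proof.
move=> X [Xsub nX minX].
pose C := [set s | `[< X (M s) >]]%SET.
have XE : X = points C.
  apply/seteqP; split=> x; last first.
    by case=> s; rewrite /= inE => /asboolP Xs <-.
  move=> Xx; have [_ [D _ <-]] := Xsub x Xx.
  rewrite vertices_perm_hull => -[s _ xs]; exists s => //=; rewrite inE.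
  by apply/asboolP; rewrite xs.
have CA : C \subset A.
  apply/fintype.subsetP => s; rewrite inE => /asboolP/Xsub[_ [D chainD <-]].
  rewrite vertices_perm_hull => /perm_pointsE; exact: (chain_mem chainD).
have [s [t [Cs Ct nst]]] : exists s t, [/\ s \in C, t \in C & ~~ (le s t || le t s)].
  apply: contrapT => no_pair; apply: nX; apply/chain_complexP; exists C => //.
  rewrite /chain_in CA; apply/forall_inP => s Cs; apply/forall_inP => t Ct.
  by apply: contraT => nst; case: no_pair; exists s, t.
have neq_st : s <> t.
  move=> eq_st; move: nst; rewrite eq_st orbb.
  by rewrite (coding_le cod) ?subxx // (fintype.subsetP CA).
exists (M s), (M t); split; first by move/perm_mx_inj.
apply: contrapT => neqX.
have subX : [set M s; M t] `<=` X by rewrite XE => x [] ->; apply/perm_pointsE.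
have /minX/chain_complexP[D chainD eqD] : [set M s; M t] `<` X.
  rewrite properEneq; split=> //; apply/eqP => eqX; exact: neqX.
have Ds : s \in D by apply/(@perm_pointsE R n); rewrite -eqD; left.
have Dt : t \in D by apply/(@perm_pointsE R n); rewrite -eqD; right.
case/andP: chainD => _ /forall_inP/(_ s Ds)/forall_inP/(_ t Dt).
by rewrite (negPf nst).
Qed.

Lemma perm_mx_integer s : integer_points (M s).
Proof.
exists (perm_mx s) => //; apply/matrixP => r c; rewrite !mxE.
by case: (s r == c).
Qed.

Theorem coded_unimodular :
  unimodular (affine_hull polytope `&` @integer_points R n)
    cells.
Proof.
move=> _ [C chainC <-]; rewrite /unimodular_simplex vertices_perm_hull; split.
  move=> _ [s Cs <-]; split; last exact: perm_mx_integer.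
  exists 1%N, (fun=> M s), (fun=> 1); split=> [_||].
  - exact/perm_hull_point/(chain_mem chainC).
  - by rewrite big_ord1.
  - by rewrite big_ord1 scale1r.
move=> x [[_ intx] [k [v [c [vC sum_c xE]]]]].
have /fin_all_exists[a aP] : forall i, exists a, [/\ forall s, 0 <= a s,
    forall s, s \notin C -> a s = 0, \sum_s a s = 1 & v i = \sum_s a s *: M s].
  by move=> i; apply/perm_hullP.
(* An affine combination of convex ones: [b] may be negative, but it still sums to 1 and lives on
   [C], which is all that [chain_coefficients] asks for. *)
pose b s := \sum_i c i * a i s.
have bC s : s \notin C -> b s = 0.
  by move=> nCs; apply: big1 => i _; have [_ -> //] := aP i; rewrite mulr0.
have sum_b : \sum_s b s = 1.
  rewrite exchange_big -sum_c; apply: eq_bigr => i _; rewrite -mulr_sumr.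
  by have [_ _ -> _] := aP i; rewrite mulr1.
have {}xE : x = \sum_s b s *: M s.
  under eq_bigr => s _ do rewrite scaler_suml.
  rewrite xE exchange_big; apply: eq_bigr => i _.
  have [_ _ _ ->] := aP i; rewrite scaler_sumr; apply: eq_bigr => s _.
  by rewrite scalerA.
have /fin_all_exists[y yE] : forall s, exists y : int, b s = y%:~R.
  move=> s; have [Cs|/bC ->] := boolP (s \in C); last by exists 0.
  have [z [Z ->]] := chain_coefficients chainC bC Cs.
  rewrite -xE; have [w ->] := entry_form_int Z intx.
  by exists (z + w); rewrite sum_b mul1r rmorphD.
exists #|C|, (fun i => M (enum_val i)), (fun i => y (enum_val i)); split.
- by move=> i; apply/perm_pointsE/enum_valP.
- apply: (@intr_inj R); rewrite rmorph_sum rmorph1 -sum_b (sum_supported bC).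
  by apply: eq_bigr => i _; rewrite yE.
- rewrite xE (@sum_supported _ _ C) => [|s /bC ->]; last by rewrite scale0r.
  by apply: eq_bigr => i _; rewrite yE.
Qed.

Lemma maximal_chain C : chain_in le A C -> exists C', [/\ chain_in le A C',
  C \subset C' & forall D, chain_in le A D -> C' \subset D -> D = C'].
Proof.
move=> chainC.
have PC : chain_in le A C && (C \subset C) by rewrite chainC subxx.
have [C' /andP[chainC' CC'] maxC'] :=
  @arg_maxnP _ C (fun D => chain_in le A D && (C \subset D)) (fun D => #|D|) PC.
exists C'; split=> // D chainD C'D; apply/eqP; rewrite eq_sym eqEcard C'D /=.
by apply: maxC'; rewrite chainD (fintype.subset_trans CC').
Qed.

(** The sum merely transports the height from permutations to matrices: at a permutation matrix it
    has a single term. *)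
Definition lifting (x : 'M[R]_n) : R := - \sum_(s | M s == x) (hgt s)%:~R.

Lemma lifting_perm s : lifting (M s) = - (hgt s)%:~R.
Proof.
rewrite /lifting (eq_bigl (pred1 s)) ?big_pred1_eq // => t.
exact: (inj_eq (@perm_mx_inj R n)).
Qed.

Local Notation Q := (lifted_polytope polytope lifting).

Lemma lifted_polytopeP z : Q z <->
  exists a, [/\ forall s, 0 <= a s, forall s, s \notin A -> a s = 0,
    \sum_s a s = 1 & z = (\sum_s a s *: M s, - \sum_s a s * (hgt s)%:~R)].
Proof.
have liftE a : \sum_s a s * lifting (M s) = - \sum_s a s * (hgt s)%:~R.
  by rewrite -sumrN; apply: eq_bigr => s _; rewrite lifting_perm mulrN.
rewrite /lifted_polytope /perm_polytope vertices_perm_hull.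
split=> [[k [v [c [vA c_ge0 sum_c ->]]]]|[a [a_ge0 aA sum_a ->]]].
  have [a [a_ge0 aA sum_a GE]] := perm_points_gather c vA.
  exists a; split=> //; [exact: a_ge0 | by rewrite sum_a|].
  by rewrite (GE _ id) -liftE (GE R^o lifting).
exists #|A|, (fun i => M (enum_val i)), (fun i => a (enum_val i)); split=> //.
- by move=> i; apply/perm_pointsE/enum_valP.
- by rewrite -sum_a (sum_supported aA).
- rewrite -liftE; congr (_, _); apply: (@sum_supported n _ A) => s /aA ->.
    by rewrite scale0r.
  by rewrite mul0r.
Qed.

Definition lifted_cell C : set ('M[R]_n * R) :=
  [set z | exists a, [/\ forall s, 0 <= a s, forall s, s \notin C -> a s = 0,
    \sum_s a s = 1 & z = (\sum_s a s *: M s, - \sum_s a s * (hgt s)%:~R)]].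

Lemma lifted_cell_point C s : s \in C -> lifted_cell C (M s, - (hgt s)%:~R).
Proof.
move=> Cs; exists (fun t => (t == s)%:R); split.
- by move=> t; rewrite ler0n.
- by move=> t; case: eqP => // -> /negP.
- by rewrite (bigD1 s) //= eqxx big1 ?addr0 // => t /negPf ->.
- congr (_, _); last congr (- _); rewrite (bigD1 s) //= eqxx ?scale1r ?mul1r.
    by rewrite big1 ?addr0 // => t /negPf ->; rewrite scale0r.
  by rewrite big1 ?addr0 // => t /negPf ->; rewrite mul0r.
Qed.

Lemma fst_lifted_cell C : fst @` lifted_cell C = cell C.
Proof.
apply/seteqP; split=> x.
  by move=> [_ [a [a_ge0 aC sum_a ->]] <-]; apply/perm_hullP; exists a.
move=> /perm_hullP[a [a_ge0 aC sum_a ->]].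
by exists (\sum_s a s *: M s, - \sum_s a s * (hgt s)%:~R) => //; exists a.
Qed.

Lemma lower_face_lifted_cell (l : {scalar 'M[R]_n}) (c : R) :
  (forall s, s \in A -> c <= l (M s) - (hgt s)%:~R) ->
  Q `&` [set z | l z.1 + z.2 = c] =
  lifted_cell [set s in A | l (M s) - (hgt s)%:~R == c]%SET.
Proof.
move=> l_ge; have sumE a : l (\sum_s a s *: M s) - \sum_s a s * (hgt s)%:~R =
    \sum_s a s * (l (M s) - (hgt s)%:~R).
  rewrite linear_sum -sumrB; apply: eq_bigr => s _; rewrite linearZ.
  by rewrite mulrBr.
apply/seteqP; split=> z.
  move=> [/lifted_polytopeP[a [a_ge0 aA sum_a ->]]]; rewrite /= sumE => sum_c.
  exists a; split=> // s; apply: contraNeq => as0.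
  have Asupp t : a t != 0 -> t \in A by apply: contraNT => /aA ->.
  rewrite inE Asupp //= -subr_eq0; apply/eqP.
  apply: (@sum_eq0_support R n (fun s => l (M s) - (hgt s)%:~R - c) a) => //.
    by move=> t at0; rewrite subr_ge0 l_ge // Asupp.
  under eq_bigr => t _ do rewrite mulrBr.
  by rewrite sumrB sum_c -mulr_suml sum_a mul1r subrr.
move=> [a [a_ge0 aW sum_a ->]]; split.
  apply/lifted_polytopeP; exists a; split=> // s nAs; apply: aW.
  by apply: contra nAs; rewrite inE => /andP[].
rewrite /= sumE; transitivity ((\sum_s a s) * c); last by rewrite sum_a mul1r.
rewrite mulr_suml; apply: eq_bigr => s _.
have [|/aW ->] := boolP (s \in [set s in A | l (M s) - (hgt s)%:~R == c]%SET).
  by rewrite inE => /andP[_ /eqP ->].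
by rewrite !mul0r.
Qed.

(** The argument of [tight_chain] again, now for a linear form with arbitrary coefficients in [R]:
    it applies because the two matrix sums agree, not just their integral affine images. *)
Lemma lower_face_chain G : lower_face Q G ->
  exists2 C, chain_in le A C & G = lifted_cell C.
Proof.
move=> [l [c [l_ge ->]]].
have l_geA s : s \in A -> c <= l (M s) - (hgt s)%:~R.
  move=> As; have /l_ge : Q (M s, - (hgt s)%:~R) by apply/lifted_polytopeP/lifted_cell_point.
  by [].
exists [set s in A | l (M s) - (hgt s)%:~R == c]%SET; last first.
  exact: lower_face_lifted_cell.
apply/andP; split; first by apply/fintype.subsetP => s; rewrite inE => /andP[].
apply/forall_inP => s; rewrite inE => /andP[As /eqP ls].
apply/forall_inP => t; rewrite inE => /andP[At /eqP lt].
rewrite !(coding_le cod) //; apply: contraT; rewrite negb_or => /andP[nst nts].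
have [m Am dm] := coding_meet cod As At.
have [p Ap dp] := coding_join cod As At.
have eqM : M s + M t = M m + M p.
  apply/matrixP => r i; rewrite !mxE.
  have := meet_join_entry cod As At Am Ap dm dp r i.
  by move/(congr1 (fun z : int => z%:~R : R)); rewrite !rmorphD.
have : (hgt s)%:~R + (hgt t)%:~R < (hgt m)%:~R + (hgt p)%:~R :> R.
  by rewrite -!rmorphD /= ltr_int (height_supermodular dm dp).
have := congr1 l eqM; rewrite !linearD.
have := l_geA m Am; have := l_geA p Ap; move: ls lt.
move: (l (M s)) (l (M t)) (l (M m)) (l (M p)) => ls lt lm lp.
lra.
Qed.

(** Enlarge a chain to a maximal one, [C]. The set where its supporting function is tight is a chain
    containing [C], hence [C] itself, so the lifted cell is a lower face. A larger lower face comes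
    from a chain containing [C], so it is no larger. *)
Theorem coded_regular : regular polytope cells.
Proof.
exists lifting; apply/seteqP; split=> S; last first.
  move=> [G [/lower_face_chain[C chainC ->] _]]; rewrite fst_lifted_cell.
  by move=> /perm_hull_face[C' C'C ->]; exists C' => //; apply: chain_inS chainC.
move=> [C0 chainC0 <-]; have [C [chainC C0C maxC]] := maximal_chain chainC0.
exists (lifted_cell C); last by rewrite fst_lifted_cell; apply: chain_subface.
have [f [aff_f hf Cf CW chainW]] := supporting_chain chainC.
have [z [Z fE]] := int_affine_form R aff_f.
have heightE s : s \in A -> entry_form Z (M s) - (hgt s)%:~R =
    - z%:~R + (f s - hgt s)%:~R.
  by move=> As; rewrite rmorphB /= fE //; ring.
have ge_z s : s \in A -> - z%:~R <= entry_form Z (M s) - (hgt s)%:~R.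
  by move=> As; rewrite heightE // lerDl ler0z subr_ge0 hf.
have faceC : Q `&` [set y | entry_form Z y.1 + y.2 = - z%:~R] = lifted_cell C.
  rewrite lower_face_lifted_cell //; congr lifted_cell.
  rewrite -(maxC _ chainW CW); apply/setP => s; rewrite !inE.
  have [As|//] := boolP (s \in A); rewrite heightE //=.
  by rewrite -subr_eq0 opprK addrC addNKr intr_eq0 subr_eq0 eq_sym.
split.
  exists (entry_form Z), (- z%:~R); split=> // y /lifted_polytopeP.
  move=> [a [a_ge0 aA sum_a ->]] /=.
  rewrite linear_sum -sumrB.
  have -> : - z%:~R = \sum_s a s * - z%:~R :> R by rewrite -mulr_suml sum_a mul1r.
  apply: ler_sum => s _.
  rewrite linearZ /= -mulrBr.
  have [As|/aA ->] := boolP (s \in A); last by rewrite !mul0r.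
  by rewrite ler_wpM2l // ge_z.
move=> G' /[dup] [[l [c [l_ge defG']]]] /lower_face_chain[D chainD ->] subG.
suff -> : D = C by [].
apply: maxC => //; apply/fintype.subsetP => s Cs.
have [a [a_ge0 aD sum_a [sM _]]] := subG _ (lifted_cell_point Cs).
by apply: (@perm_hull_mem R n); rewrite sM; apply/perm_hullP; exists a.
Qed.

End CodedTriangulation.

(** * The toric ideal *)

Section IdealGen.
Variable D : comNzRingType.
Implicit Types (G : set D) (p q : D).

Lemma ideal_gen0 G : ideal_gen G 0.
Proof. by exists 0%N, (fun=> 0), (fun=> 0); split=> [[]|]; rewrite ?big_ord0. Qed.

Lemma ideal_genD G p q : ideal_gen G p -> ideal_gen G q -> ideal_gen G (p + q).
Proof.
move=> [k [a [g [gG ->]]]] [k' [a' [g' [g'G ->]]]].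
pose glue (u : 'I_k -> D) (u' : 'I_k' -> D) i :=
  match split i with inl j => u j | inr j => u' j end.
exists (k + k')%N, (glue a a'), (glue g g'); split.
  by move=> i; rewrite /glue; case: (split i).
by rewrite big_split_ord /=; congr (_ + _); apply: eq_bigr => i _;
  rewrite /glue -?[lshift _ i]/(unsplit (inl i)) -?[rshift _ i]/(unsplit (inr i)) unsplitK.
Qed.

Lemma ideal_genM G p q : ideal_gen G q -> ideal_gen G (p * q).
Proof.
move=> [k [a [g [gG ->]]]]; exists k, (fun i => p * a i), g; split=> //.
by rewrite mulr_sumr; apply: eq_bigr => i _; rewrite mulrA.
Qed.

Lemma ideal_gen_sum G (I : eqType) (r : seq I) (F : I -> D) :
  (forall i, i \in r -> ideal_gen G (F i)) -> ideal_gen G (\sum_(i <- r) F i).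
Proof.
move=> FG; rewrite big_seq; elim/big_ind: _ => //; first exact: ideal_gen0.
by move=> x y; apply: ideal_genD.
Qed.

Lemma ideal_gen_mem G p : G p -> ideal_gen G p.
Proof.
by move=> Gp; exists 1%N, (fun=> 1), (fun=> p); split=> //; rewrite big_ord1 mul1r.
Qed.

Lemma ideal_gen_sub G G' : G `<=` ideal_gen G' -> ideal_gen G `<=` ideal_gen G'.
Proof.
move=> GG' _ [k [a [g [gG ->]]]]; apply: ideal_gen_sum => i _.
exact/ideal_genM/GG'.
Qed.

End IdealGen.

Section ToricMap.
Variables (K : fieldType) (n : nat) (A : {set 'S_n}).
Local Notation S := {mpoly K[#|A|]}.
Local Notation var := (@var_perm n A).
Implicit Types (m : 'X_{1..#|A|}) (p : S).

Definition perm_exponent (s : 'S_n) : 'X_{1..n * n} :=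
  (\sum_(r < n) U_(mxvec_index r (s r)))%MM.

Definition toric_exponent m : 'X_{1..n * n} :=
  (\sum_(i < #|A|) perm_exponent (var i) *+ m i)%MM.

Lemma mxvec_index_inj (r r' c c' : 'I_n) :
  (mxvec_index r c == mxvec_index r' c') = ((r, c) == (r', c')).
Proof. by rewrite /mxvec_index (inj_eq (@cast_ord_inj _ _ _)) (inj_eq enum_rank_inj). Qed.

Lemma perm_exponentE s r c : perm_exponent s (mxvec_index r c) = (s r == c).
Proof.
rewrite mnm_sumE (bigD1 r) //= big1 => [|i /negPf ir].
  by rewrite addn0 mnm1E mxvec_index_inj xpair_eqE eqxx.
by rewrite mnm1E mxvec_index_inj xpair_eqE ir.
Qed.

Lemma toric_exponentE m r c :
  toric_exponent m (mxvec_index r c) = (\sum_i m i * (var i r == c))%N.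
Proof.
rewrite mnm_sumE; apply: eq_bigr => i _.
by rewrite mulmnE perm_exponentE mulnC.
Qed.

Definition toric_var (i : 'I_#|A|) : {poly {mpoly K[n * n]}} :=
  (\prod_(r < n) \prod_(c < n)
     'X_(mxvec_index r c) ^+ (var i r == c))%:P * 'X.

Lemma toric_varE i : toric_var i = ('X_[perm_exponent (var i)])%:P * 'X.
Proof.
congr (_%:P * _); rewrite -mprodXE; apply: eq_bigr => r _.
rewrite (bigD1 (var i r)) //= eqxx expr1 big1 ?mulr1 // => c.
by rewrite eq_sym => /negPf->; rewrite expr0.
Qed.

Lemma mmap1_toric_var m :
  mmap1 toric_var m = ('X_[toric_exponent m])%:P * 'X^(mdeg m).
Proof.
rewrite -mprodXnE rmorph_prod mdegE -prodrXr -big_split.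
by apply: eq_bigr => i _; rewrite toric_varE exprMn rmorphXn.
Qed.

Lemma toric_mapE p : toric_map p =
  \sum_(m <- msupp p) (p@_m *: 'X_[toric_exponent m])%:P * 'X^(mdeg m).
Proof.
transitivity (\sum_(m <- msupp p) (p@_m)%:MP%:P * mmap1 toric_var m).
  by [].
apply: eq_bigr => m _.
by rewrite mmap1_toric_var mulrA -polyCM mul_mpolyC.
Qed.

(** The image of [p] has, at each pair of an exponent and a degree, the sum of the coefficients of
    [p] over one fibre. A monomial alone in its fibre would have coefficient 0. *)
Lemma toric_ideal_partner p m : toric_ideal p -> m \in msupp p ->
  exists m', [/\ m' \in msupp p, m' != m, mdeg m' = mdeg m &
    toric_exponent m' = toric_exponent m].
Proof.
move=> Ip pm; apply: contrapT => no_partner.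
have := congr1 (fun q : {poly {mpoly K[n * n]}} => (q`_(mdeg m))@_(toric_exponent m)) Ip.
rewrite toric_mapE coef_sum raddf_sum /= (bigD1_seq m) ?msupp_uniq //=.
rewrite coefCM coefXn eqxx mulr1 mcoeffZ mcoeffX eqxx mulr1 big_seq_cond big1.
  by rewrite addr0 coef0 mcoeff0 => /eqP; rewrite mcoeff_eq0 pm.
move=> m' /andP[pm' neq_m]; rewrite coefCM coefXn.
have [deg_eq|_] := eqVneq; last by rewrite mulr0 mcoeff0.
rewrite mulr1 mcoeffZ mcoeffX; case: eqP => [exp_eq|_]; last by rewrite mulr0.
by case: no_partner; exists m'.
Qed.

Lemma toric_binomial m m' : mdeg m = mdeg m' ->
  toric_exponent m = toric_exponent m' ->
  toric_ideal ('X_[m] - 'X_[m'] : S).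
Proof.
move=> deg_eq exp_eq.
have mmapE p : toric_map p = mmap (polyC \o @mpolyC (n * n) K) toric_var p by [].
have monE u : toric_map ('X_[u] : S) = 'X_[toric_exponent u]%:P * 'X^(mdeg u).
  by rewrite toric_mapE msuppX big_seq1 mcoeffX eqxx scale1r.
by rewrite /toric_ideal /= mmapE mmapB -!mmapE !monE deg_eq exp_eq subrr.
Qed.

End ToricMap.

(** * The initial ideal and the Stanley-Reisner ideal *)

Section CodedReverseLex.
Variables (R : realFieldType) (K : fieldType) (n : nat) (J : finType).
Variables (le : rel 'S_n) (A : {set 'S_n}) (d : 'S_n -> {set J}).
Hypothesis cod : order_coding le A d.
Local Notation S := {mpoly K[#|A|]}.
Local Notation var := (@var_perm n A).
Local Notation cells := (@chain_cells R n le A).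
Implicit Types (m : 'X_{1..#|A|}) (p : S) (N : {set 'I_#|A|}).

Definition var_chain N : bool := chain_in le A [set var i | i in N]%SET.
Definition msupport m : {set 'I_#|A|} := [set i | (0 < m i)%N]%SET.

Lemma var_mem i : var i \in A. Proof. exact: enum_valP. Qed.

Lemma var_chainP N : reflect {in N &, forall i j, le (var i) (var j) || le (var j) (var i)}
  (var_chain N).
Proof.
apply: (iffP andP) => [[_ /forall_inP cmp] i j Ni Nj|cmp].
  by apply: (forall_inP (cmp _ _)); apply: imset_f.
split; first by apply/fintype.subsetP => _ /imsetP[i _ ->]; apply: var_mem.
apply/forall_inP => _ /imsetP[i Ni ->]; apply/forall_inP => _ /imsetP[j Nj ->].
exact: cmp.
Qed.

Lemma var_nonchain N : ~~ var_chain N -> exists i j,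
  [/\ i \in N, j \in N, ~~ le (var i) (var j) & ~~ le (var j) (var i)].
Proof.
move=> nchain; apply: contrapT => no_pair; move/var_chainP: nchain; apply.
move=> i j Ni Nj; apply: contraT; rewrite negb_or => /andP[nij nji].
by case: no_pair; exists i, j.
Qed.

Lemma complex_var_chain N :
  abstract_complex cells (@perm_points R n [set var i | i in N]%SET) <-> var_chain N.
Proof.
split=> [/chain_complexP[C chainC /perm_points_inj eqC]|chainN].
  by rewrite /var_chain eqC.
by apply/chain_complexP; exists [set var i | i in N]%SET.
Qed.

(** By [coding_form], the weight of [j] in a monomial is an integral affine function of its degree
    and toric exponent, so it is constant on fibres. The count is one of integers, whatever the
    characteristic of [K]. *)
Lemma coded_sum_eq m m' j : toric_exponent m = toric_exponent m' -> mdeg m = mdeg m' ->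
  (\sum_i m i * (j \in d (var i)) = \sum_i m' i * (j \in d (var i)))%N.
Proof.
move=> exp_eq deg_eq; have [z [Z fE]] := coding_form cod j.
have sumE (u : 'X_{1..#|A|}) : (\sum_i u i * (j \in d (var i)))%:Z =
    z * (mdeg u)%:Z + \sum_r \sum_c Z r c * (toric_exponent u (mxvec_index r c))%:Z.
  transitivity (\sum_i (u i)%:Z * (z + \sum_r Z r (var i r))).
    rewrite -natz natr_sum; apply: eq_bigr => i _.
    by rewrite -fE ?var_mem // natrM !natz.
  under eq_bigr => i _ do rewrite mulrDr.
  rewrite big_split /=; congr (_ + _).
    rewrite -mulr_suml mulrC mdegE -[X in _ = _ * X]natz natr_sum; congr (_ * _).
    by apply: eq_bigr => i _; rewrite natz.
  under eq_bigr => i _ do rewrite mulr_sumr.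
  rewrite exchange_big; apply: eq_bigr => r _.
  under [RHS]eq_bigr => c _ do rewrite toric_exponentE -natz natr_sum mulr_sumr.
  rewrite [RHS]exchange_big; apply: eq_bigr => i _; rewrite (bigD1 (var i r)) //=.
  rewrite eqxx muln1 natz mulrC big1 ?addr0 // => c; rewrite eq_sym => /negPf->.
  by rewrite muln0 mulr0.
by apply/eqP; rewrite -eqz_nat !sumE exp_eq deg_eq.
Qed.

(* A monomial supported on a chain is the smallest of its fibre.  At the first
   variable t_s where m' exceeds m, forget the smaller variables, on which the
   two agree: the least element t of the rest of the chain is not below s, so
   some j in d t \ d s has too small a weight in m'. *)
Lemma chain_monomial_least m m' : var_chain (msupport m) ->
  toric_exponent m' = toric_exponent m -> mdeg m' = mdeg m -> ~~ grevlex_lt m' m.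
Proof.
move=> chain_m exp_eq deg_eq; rewrite /grevlex_lt deg_eq ltnn eqxx /=.
apply/existsP => -[i /andP[lt_i /forallP eq_lt]].
have {}eq_lt k : var_lt k i -> m' k = m k by move/(implyP (eq_lt k))/eqP.
pose rest := [pred k | ~~ var_lt k i].
have rest_eq (w : 'I_#|A| -> nat) : (\sum_k m k * w k = \sum_k m' k * w k)%N ->
    (\sum_(k in rest) m k * w k = \sum_(k in rest) m' k * w k)%N.
  rewrite (bigID rest) [RHS](bigID rest) /= => /eqP.
  rewrite [X in (_ + X)%N == _](_ : _ =
    \sum_(k | ~~ rest k) m' k * w k)%N ?eqn_add2r => [/eqP //|].
  by apply: eq_bigr => k; rewrite negbK => /eq_lt ->.
have resti : i \in rest by rewrite inE /= /var_lt perm_lex_lt_irr.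
have deg_rest : (\sum_(k in rest) m k = \sum_(k in rest) m' k)%N.
  have mul1 (P : pred 'I_#|A|) (u : 'X_{1..#|A|}) :
      (\sum_(k | P k) u k * 1 = \sum_(k | P k) u k)%N.
    by apply: eq_bigr => k _; rewrite muln1.
  by have := rest_eq (fun=> 1%N); rewrite /= !mul1 -!mdegE deg_eq; apply.
have deg_rest' : (m i + \sum_(k in rest | k != i) m k =
    m' i + \sum_(k in rest | k != i) m' k)%N.
  by rewrite -!bigD1.
pose U := [set var k | k in [set k in msupport m | (k \in rest) && (k != i)]]%SET.
have [U0|U_neq0] := eqVneq U finset.set0.
  suff sum0 : (\sum_(k in rest | k != i) m k = 0)%N.
    move: deg_rest' lt_i; rewrite sum0.
    by move: (m i) (m' i) (\sum_(k in rest | k != i) m' k)%N => x y z; lia.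
  apply: big1 => k Pk; apply/eqP; rewrite -leqn0 leqNgt; apply/negP => mk.
  have : var k \in U by apply: imset_f; rewrite !inE mk.
  by rewrite U0 inE.
have UC : U \subset [set var k | k in msupport m]%SET.
  by apply: imsetS; apply/fintype.subsetP => k; rewrite !inE => /andP[].
have [t Ut min_t] := chain_min cod chain_m UC U_neq0.
have [k0 + tE] := imsetP Ut; rewrite !inE => /and3P[_ rest_k0 k0i].
(* A variable below [var i] in the weak order is lexicographically smaller, and those have been
   removed from [rest]. *)
have /subsetPn[j jt nji] : ~~ (d t \subset d (var i)).
  apply: contra rest_k0; rewrite tE -(coding_le cod) ?var_mem // => le_k0i.
  apply: (coding_lex cod) => //; rewrite ?var_mem //.
  by rewrite (inj_eq enum_val_inj).
have := rest_eq _ (coded_sum_eq j (esym exp_eq) (esym deg_eq)).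
rewrite (bigD1 i) //= [RHS](bigD1 i) //= (negPf nji) !muln0 !add0n.
rewrite (eq_bigr m) => [sum_eq|k /andP[rest_k ki]]; last first.
  have [->|] := posnP (m k); first by rewrite mul0n.
  move=> mk; rewrite (fintype.subsetP (min_t (var k) _) j jt) ?muln1 //.
  by apply: imset_f; rewrite !inE mk ki andbT.
have : (\sum_(k in rest | k != i) m' k * (j \in d (var k)) <=
    \sum_(k in rest | k != i) m' k)%N.
  by apply: leq_sum => k _; case: (j \in _); rewrite ?muln1 ?muln0.
move: sum_eq deg_rest' lt_i; rewrite /=; lia.
Qed.

(** The partner of the leading monomial in its fibre would be smaller than it, impossible if the
    leading monomial is the least of that fibre. *)
Lemma leading_nonchain p m : toric_ideal p -> leading_monomial p m ->
  ~~ var_chain (msupport m).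
Proof.
move=> Ip [pm lead_m]; have [m' [pm' neq_m deg_eq exp_eq]] := toric_ideal_partner Ip pm.
by apply: contraL (lead_m m' pm' neq_m) => /chain_monomial_least ->.
Qed.

(** Sets the variables outside [N] to zero. For a face [N] it kills the face ideal, and its target
    is a domain; this is how powers are handled. *)
Definition chain_proj N : S -> S :=
  mmap (@mpolyC #|A| K) (fun i => if i \in N then 'X_i else 0).

Lemma chain_projM N : {morph chain_proj N : p q / p * q}.
Proof. by move=> p q; apply: (mmap_is_multiplicative _ _).1. Qed.

Lemma chain_projX N p k : chain_proj N (p ^+ k) = chain_proj N p ^+ k.
Proof.
elim: k => [|k IHk]; last by rewrite !exprS chain_projM IHk.
exact: (mmap_is_multiplicative _ _).2.
Qed.

Lemma chain_proj_monomial N m :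
  chain_proj N 'X_[m] = if msupport m \subset N then 'X_[m] else 0.
Proof.
rewrite /chain_proj mmapX /mmap1; case: ifPn => [/fintype.subsetP sub|/subsetPn[i]].
  rewrite [RHS]mpolyXE_id; apply: eq_bigr => i _.
  have [->|mi] := posnP (m i); first by rewrite !expr0.
  by rewrite sub ?inE.
rewrite inE => mi /negPf niN; rewrite (bigD1 i) //= niN.
by rewrite expr0n; case: (m i) mi => //=; rewrite mul0r.
Qed.

Lemma chain_proj_sum N (I : Type) (r : seq I) (F : I -> S) :
  chain_proj N (\sum_(i <- r) F i) = \sum_(i <- r) chain_proj N (F i).
Proof. exact: raddf_sum. Qed.

Lemma mcoeff_chain_proj N p m : msupport m \subset N -> (chain_proj N p)@_m = p@_m.
Proof.
move=> sub; rewrite {1}[p]mpolyE chain_proj_sum raddf_sum /=.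
transitivity (\sum_(u <- msupp p) (p@_u *: 'X_[u])@_m).
  apply: eq_bigr => u _; rewrite -mul_mpolyC chain_projM /=.
  rewrite [chain_proj N _%:MP]mmapC !mcoeffCM chain_proj_monomial.
  case: ifPn => // nsub; rewrite mcoeff0 mcoeffX.
  by case: eqP => // eq_um; rewrite eq_um sub in nsub.
by rewrite -raddf_sum /= -mpolyE.
Qed.

Definition face_gens : set S := [set \prod_(i in N) 'X_i | N in
  [set N : {set 'I_#|A|} | ~~ var_chain N]].

Lemma stanley_reisnerE : @stanley_reisner_ideal K n A R cells = ideal_gen face_gens.
Proof.
congr ideal_gen; apply/seteqP; split=> _ [N nN <-]; exists N => //=.
  by apply/negP => /complex_var_chain.
by move/complex_var_chain; apply/negP.
Qed.

Lemma prod_varE N : \prod_(i in N) 'X_i = 'X_[\sum_(i in N) U_(i)] :> S.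
Proof. by rewrite mprodXE. Qed.

Lemma sum_varE N i : (\sum_(k in N) U_(k))%MM i = (i \in N) :> nat.
Proof.
rewrite mnm_sumE big_mkcond (bigD1 i) //= mnm1E eqxx big1 ?addn0 => [|k /negPf ki].
  by case: (i \in N).
by rewrite mnm1E ki if_same.
Qed.

Lemma chain_proj_face N p : var_chain N -> ideal_gen face_gens p ->
  chain_proj N p = 0.
Proof.
move=> chainN [k [a [g [gG ->]]]]; rewrite chain_proj_sum big1 // => i _.
have [N' nN' <-] := gG i; rewrite chain_projM prod_varE chain_proj_monomial.
rewrite ifN ?mulr0 //; apply: contra nN' => /fintype.subsetP sub.
apply/var_chainP => u v N'u N'v; apply: (var_chainP _ chainN);
  by apply: sub; rewrite inE sum_varE ?N'u ?N'v.
Qed.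

(** A monomial with a nonface as support is divisible by the squarefree monomial of that support. If
    the support is a face, projecting onto it kills the ideal but keeps the coefficient. *)
Lemma face_idealP p : ideal_gen face_gens p <->
  forall m, m \in msupp p -> ~~ var_chain (msupport m).
Proof.
split=> [Ip m pm|nonchain]; last first.
  rewrite [p]mpolyE; apply: ideal_gen_sum => m /nonchain nm.
  rewrite -mul_mpolyC; apply: ideal_genM.
  have le_m : (\sum_(k in msupport m) U_(k) <= m)%MM.
    apply/mnm_lepP => i; rewrite sum_varE inE; by case: (m i).
  rewrite -(submK le_m) mpolyXD; apply/ideal_genM/ideal_gen_mem.
  by exists (msupport m) => //; rewrite prod_varE.
apply/negP => chain_m.
have := chain_proj_face chain_m Ip.
move=> /(congr1 (mcoeff m)); rewrite mcoeff_chain_proj // mcoeff0 => /eqP.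
by rewrite mcoeff_eq0 pm.
Qed.

Lemma incomparable_initial i j : ~~ le (var i) (var j) -> ~~ le (var j) (var i) ->
  initial_ideal (@toric_ideal K n A) ('X_i * 'X_j).
Proof.
move=> nij nji.
have [s As ds] := coding_meet cod (var_mem i) (var_mem j).
have [t At dt] := coding_join cod (var_mem i) (var_mem j).
pose a := enum_rank_in As s; pose b := enum_rank_in As t.
have va : var a = s by rewrite /var_perm enum_rankK_in.
have vb : var b = t by rewrite /var_perm enum_rankK_in.
have ij : i != j by apply: contraNneq nij => ->; rewrite (coding_le cod) ?var_mem ?subxx.
have lt_var u v : le (var u) (var v) -> u != v -> var_lt u v.
  move=> uv neq; apply: (coding_lex cod) => //; rewrite ?var_mem //.
  by rewrite (inj_eq enum_val_inj).
have le_ai : le (var a) (var i) by rewrite (coding_le cod) ?var_mem // va ds finset.subsetIl.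
have le_aj : le (var a) (var j) by rewrite (coding_le cod) ?var_mem // va ds finset.subsetIr.
have le_ib : le (var i) (var b) by rewrite (coding_le cod) ?var_mem // vb dt finset.subsetUl.
have ai : a != i by apply: contraNneq nij => <-.
have aj : a != j by apply: contraNneq nji => <-.
have lt_ai := lt_var a i le_ai ai; have lt_aj := lt_var a j le_aj aj.
have lt_ab : var_lt a b.
  have [ib|ib] := eqVneq i b; first by rewrite -ib.
  exact: perm_lex_lt_trans lt_ai (lt_var i b le_ib ib).
have not_lt u v : var_lt u v -> var_lt v u = false.
  move=> uv; apply/negbTE/negP => /(perm_lex_lt_trans uv).
  by rewrite perm_lex_lt_irr.
rewrite -mpolyXD; apply: ideal_gen_mem; exists (U_(i) + U_(j))%MM => //=.
have neqM : (U_(a) + U_(b) != U_(i) + U_(j))%MM.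
  apply/eqP => /mnmP/(_ a); rewrite !mnmDE !mnm1E eqxx.
  by rewrite !(eq_sym _ a) (negPf ai) (negPf aj).
exists ('X_[U_(i) + U_(j)] - 'X_[U_(a) + U_(b)]).
  apply: toric_binomial; first by rewrite !mdegD !mdeg1.
  apply/mnmP => k; case/mxvec_indexP: k => r c; rewrite !toric_exponentE.
  have expE u v : (\sum_k (U_(u) + U_(v))%MM k * (var k r == c) =
      (var u r == c) + (var v r == c))%N.
    have sum1 w : (\sum_k U_(w)%MM k * (var k r == c) = (var w r == c))%N.
      rewrite (bigD1 w) //= mnm1E eqxx mul1n big1 ?addn0 // => k /negPf kw.
      by rewrite mnm1E eq_sym kw.
    under eq_bigr => k _ do rewrite mnmDE mulnDl.
    by rewrite big_split /= !sum1.
  rewrite !expE va vb; apply/eqP; rewrite -eqz_nat !PoszD; apply/eqP.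
  exact: (meet_join_entry cod (var_mem i) (var_mem j)).
have coefE u : ('X_[U_(i) + U_(j)] - 'X_[U_(a) + U_(b)] : S)@_u =
    (U_(i) + U_(j) == u)%MM%:R - (U_(a) + U_(b) == u)%MM%:R.
  by rewrite mcoeffB !mcoeffX.
split; first by rewrite mcoeff_msupp coefE eqxx (negPf neqM) subr0 oner_eq0.
move=> u; rewrite mcoeff_msupp coefE [in X in X -> _]eq_sym => nz neq_u.
have <- : (U_(a) + U_(b))%MM = u.
  apply/eqP; apply: contraNT nz => /negPf ->.
  by rewrite eq_sym in neq_u; rewrite ?(negPf neq_u) ?(eq_sym u) ?(negPf neq_u) subrr.
(* The meet [a] is the smallest variable occurring in the binomial, and only in its second term. The
   reverse lexicographic comparison is therefore decided at [a], against that term. *)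
rewrite /grevlex_lt !mdegD !mdeg1 eqxx ltnn /=; apply/existsP; exists a.
rewrite !mnmDE !mnm1E eqxx !(eq_sym _ a) (negPf ai) (negPf aj) /=.
apply/forallP => k; apply/implyP => lt_ka; rewrite !mnmDE !mnm1E.
have neq v : var_lt a v -> (v == k) = false.
  move=> lt_av; apply: contraTF lt_ka => /eqP <-; by rewrite not_lt.
have -> : (a == k) = false.
  by apply/negbTE; apply: contraTneq lt_ka => <-; rewrite /var_lt perm_lex_lt_irr.
by rewrite !neq.
Qed.

(** A nonface monomial is a multiple of an incomparable product, so it lies in the initial ideal
    itself. Conversely the initial ideal lies in the face ideal, which is radical: if a power of [p]
    projects to zero on a face, so does [p]. *)
Theorem coded_reverse_lexicographic : @reverse_lexicographic K n A R cells.
Proof.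
rewrite /reverse_lexicographic stanley_reisnerE.
have init_face : initial_ideal (@toric_ideal K n A) `<=` ideal_gen face_gens.
  apply: ideal_gen_sub => _ [m [p Ip lead_m] <-]; apply/face_idealP => u.
  by rewrite msuppX inE => /eqP ->; apply: leading_nonchain Ip lead_m.
apply/seteqP; split=> p.
  move=> Fp; exists 1%N; rewrite expr1; move: p Fp; apply: ideal_gen_sub.
  move=> _ [N /= /var_nonchain[i [j [Ni Nj nij nji]]] <-].
  have neq_ji : j != i.
    by apply: contraNneq nij => ->; rewrite (coding_le cod) ?var_mem ?subxx.
  rewrite (bigD1 i) //= (bigD1 j) ?Nj //= mulrA mulrC.
  exact/ideal_genM/incomparable_initial.
move=> [k /init_face Fpk]; apply/face_idealP => m pm; apply/negP => chain_m.
have := chain_proj_face chain_m Fpk.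
rewrite chain_projX => /eqP; rewrite expf_eq0 => /andP[_ /eqP].
move=> /(congr1 (mcoeff m)); rewrite mcoeff_chain_proj // mcoeff0 => /eqP.
by rewrite mcoeff_eq0 pm.
Qed.

End CodedReverseLex.

(** * Biclosed sets of pairs *)

Section InversionSets.
Variable n : nat.
Implicit Types (s t u v : 'S_n) (E : {set 'I_n * 'I_n}).

Definition inversion_set s : {set 'I_n * 'I_n} := [set p | inversion s p]%SET.

Lemma inversion_setE s (i j : 'I_n) :
  ((i, j) \in inversion_set s) = (i < j)%N && (s j < s i)%N.
Proof. by rewrite inE. Qed.

Lemma left_weak_le_inversion_set s t :
  left_weak_le s t = (inversion_set s \subset inversion_set t).
Proof.
apply/left_weak_leP/fintype.subsetP => sub p; last by have := sub p; rewrite !inE.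
by rewrite !inE; apply: sub.
Qed.

(** The classical description of inversion sets: the set and its complement among increasing pairs
    are both transitive. *)
Definition biclosed E : Prop :=
  (forall p, p \in E -> p.1 < p.2)%N /\ forall i j k : 'I_n, (i < j)%N -> (j < k)%N ->
    ((i, j) \in E) && ((j, k) \in E) ==> ((i, k) \in E) /\
    ((i, k) \in E) ==> ((i, j) \in E) || ((j, k) \in E).

Lemma biclosed_inversion_set s : biclosed (inversion_set s).
Proof.
split=> [[i j]|i j k ij jk]; first by rewrite inE => /andP[].
by rewrite !inversion_setE ij jk (ltn_trans ij jk) /=; split; lia.
Qed.

(** [prec i j] prescribes that position [i] receive a smaller letter than position [j]. Biclosedness
    makes this a strict total order, and the permutation sends each position to the number of its
    predecessors. *)
Lemma biclosed_realize E : biclosed E -> exists s, inversion_set s = E.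
Proof.
move=> [ltE triE].
have sumE (i j k : 'I_n) : (i < j)%N -> (j < k)%N ->
    (i, j) \in E -> (j, k) \in E -> (i, k) \in E.
  move=> ij jk ijE jkE.
  by have [/implyP H _] := triE i j k ij jk; apply: H; rewrite ijE.
have splitE (i j k : 'I_n) : (i < j)%N -> (j < k)%N ->
    (i, k) \in E -> (i, j) \in E \/ (j, k) \in E.
  by move=> ij jk ikE; have [_ /implyP/(_ ikE)/orP] := triE i j k ij jk.
pose prec (i j : 'I_n) := if (i < j)%N then (i, j) \notin E else (j, i) \in E.
have prec_total i j : i != j -> prec i j = ~~ prec j i.
  by rewrite /prec -(inj_eq val_inj) /=; case: ltngtP => // _ _; rewrite negbK.
have prec_irr i : prec i i = false.
  by rewrite /prec ltnn; apply/negP => /ltE; rewrite ltnn.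
have prec_trans j i k : prec i j -> prec j k -> prec i k.
  have [->|ij] := eqVneq i j; first by rewrite prec_irr.
  have [->|jk] := eqVneq j k; first by rewrite prec_irr.
  have [->|ik] := eqVneq i k; first by rewrite (prec_total k j) 1?eq_sym // => /negbTE ->.
  (* One case for each relative order of [i], [j], [k]; each is one of the two conditions on [E],
     possibly contraposed. *)
  move: ij jk ik; rewrite /prec -!(inj_eq val_inj) /=.
  case: (ltngtP i j) => // ij _; case: (ltngtP j k) => // jk _;
    case: (ltngtP i k) => // ik _; try by move: ij jk ik; lia.
  - by move=> nij njk; apply/negP => /(splitE _ _ _ ij jk)[]; apply/negP.
  - by move=> nij kj; apply: contra nij => /(sumE _ _ _ ik jk); apply.
  - by move=> nij /(splitE _ _ _ ik ij)[] // /(negP nij).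
  - by move=> ji njk; apply: contra njk => /(sumE _ _ _ ij ik ji).
  - by move=> /(splitE _ _ _ jk ik)[] // jk' /negP.
  - by move=> ji kj; apply: (sumE _ _ _ jk ij).
pose below i := [set j | prec j i]%SET.
have below_lt i : (#|below i| < n)%N.
  rewrite -[ltnRHS]card_ord -cardsT; apply: proper_card; apply/properP; split=> //.
  by exists i; rewrite ?inE ?prec_irr.
have below_mono i j : prec i j -> (#|below i| < #|below j|)%N.
  move=> ij; apply: proper_card; apply/properP; split.
    by apply/fintype.subsetP => k; rewrite !inE => /prec_trans; apply.
  by exists i; rewrite !inE ?prec_irr.
pose f i := Ordinal (below_lt i).
have f_inj : injective f.
  move=> i j /(congr1 val) /= eq_ij; apply/eqP; apply: contraT => ij.
  have := prec_total i j ij; case: (boolP (prec i j)) => [/below_mono|_ /esym/negbFE/below_mono];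
    by rewrite eq_ij ltnn.
exists (perm f_inj); apply/setP => -[i j]; rewrite inversion_setE !permE /=.
have [ij|ji] := ltnP i j; last by apply/esym/negP => /ltE /=; rewrite ltnNge ji.
have -> : ((i, j) \in E) = prec j i by rewrite /prec ltnNge (ltnW ij).
apply/idP/idP => [|/below_mono //]; apply: contraTT => nji.
have neq : i != j by apply: contraTneq ij => ->; rewrite ltnn.
by rewrite -leqNgt ltnW // below_mono // prec_total.
Qed.

Lemma card_ord_lt (k : nat) : (k <= n)%N -> #|[set i : 'I_n | (i < k)%N]%SET| = k.
Proof.
by move=> kn; rewrite -sum1dep_card -(big_ord_widen n (fun=> 1%N) kn) sum1_card card_ord.
Qed.

Lemma card_ord_interval (a b : nat) :
  (b <= n)%N -> #|[set i : 'I_n | (a <= i < b)%N]%SET| = (b - a)%N.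
Proof.
move=> bn; have [ab|/ltnW ba] := leqP a b; last first.
  by apply/eqP; rewrite (eqP ba) cards_eq0; apply/eqP/setP => i; rewrite !inE; lia.
have -> : [set i : 'I_n | (a <= i < b)%N]%SET =
    ([set i : 'I_n | (i < b)%N] :\: [set i : 'I_n | (i < a)%N])%SET.
  by apply/setP => i; rewrite !inE -leqNgt.
have := cardsID [set i : 'I_n | (i < a)%N]%SET [set i : 'I_n | (i < b)%N]%SET.
rewrite card_ord_lt // (_ : (_ :&: _)%SET = [set i : 'I_n | (i < a)%N]%SET).
  by rewrite card_ord_lt ?(leq_trans ab) //; lia.
by apply/setP => i; rewrite !inE; lia.
Qed.

Lemma card_below s (r : 'I_n) : #|[set l | (s l < s r)%N]%SET| = s r.
Proof.
rewrite -(card_imset _ (@perm_inj _ s)) -[RHS](card_ord_lt (ltnW (ltn_ord (s r)))).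
apply: eq_card => i; rewrite inE; apply/imsetP/idP => [[l + ->]|lt_i].
  by rewrite inE.
by exists (s^-1%g i); rewrite ?inE permKV.
Qed.

Lemma perm_entryB s (r c : 'I_n) : ((s r == c)%:Z = (c <= s r)%:Z - (c < s r)%:Z)%R.
Proof. by rewrite -(inj_eq val_inj) /=; case: ltngtP. Qed.

End InversionSets.

(** * Integral affine functions of the coding *)

Section CodedAffine.
Variables (n : nat) (A : {set 'S_n}) (J : finType) (d : 'S_n -> {set J}).
Implicit Types (f g : 'S_n -> int).

Definition coded_affine f : Prop := exists (u0 : int) (u : J -> int),
  {in A, forall s, f s = u0 + \sum_j u j * (j \in d s)%:Z}.

Lemma eq_coded_affine f g : {in A, f =1 g} -> coded_affine f -> coded_affine g.
Proof. by move=> fg [u0 [u fE]]; exists u0, u => s As; rewrite -fg ?fE. Qed.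

Lemma coded_affine_cst z : coded_affine (fun=> z).
Proof. by exists z, (fun=> 0) => s _; rewrite big1 ?addr0 // => j _; rewrite mul0r. Qed.

Lemma coded_affine_mem j : coded_affine (fun s => (j \in d s)%:Z).
Proof.
exists 0, (fun k => (k == j)%:Z) => s _; rewrite add0r (bigD1 j) //= eqxx mul1r.
by rewrite big1 ?addr0 // => k /negPf ->; rewrite mul0r.
Qed.

Lemma coded_affineB f g :
  coded_affine f -> coded_affine g -> coded_affine (fun s => f s - g s).
Proof.
move=> [u0 [u fE]] [w0 [w gE]]; exists (u0 - w0), (fun j => u j - w j) => s As.
rewrite fE ?gE // opprD addrACA -sumrB; congr (_ + _).
by apply: eq_bigr => j _; rewrite mulrBl.
Qed.

Lemma coded_affineD f g :
  coded_affine f -> coded_affine g -> coded_affine (fun s => f s + g s).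
Proof.
move=> aff_f aff_g.
apply: eq_coded_affine (coded_affineB aff_f (coded_affineB (coded_affine_cst 0) aff_g)).
by move=> s _; rewrite sub0r opprK.
Qed.

Lemma coded_affine_sum (I : Type) (r : seq I) (P : pred I) (F : I -> 'S_n -> int) :
  (forall i, P i -> coded_affine (F i)) ->
  coded_affine (fun s => \sum_(i <- r | P i) F i s).
Proof.
move=> affF; elim: r => [|i r IHr].
  by apply: eq_coded_affine (coded_affine_cst 0) => s _; rewrite big_nil.
have [Pi|nPi] := boolP (P i); last first.
  by apply: eq_coded_affine IHr => s _; rewrite big_cons (negPf nPi).
apply: eq_coded_affine (coded_affineD (affF i Pi) IHr) => s _.
by rewrite big_cons Pi.
Qed.

(** [v] stands for [s] itself in one family and for [s^-1] in the other. Depending on the order of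
    [l] and [r], the comparison is an inversion or the complement of one. *)
Lemma coded_affine_lt (v : 'S_n -> 'S_n) (l r : 'I_n) (pair : 'I_n * 'I_n -> J) :
  (forall s p, (pair p \in d s) = (p \in inversion_set (v s))) ->
  coded_affine (fun s => (v s l < v s r)%N%:Z).
Proof.
move=> dE; have [lr|rl|/val_inj ->] := ltngtP l r.
- apply: eq_coded_affine (coded_affineB (coded_affine_cst 1)
    (coded_affine_mem (pair (l, r)))) => s _.
  rewrite dE inversion_setE lr /=; case: ltngtP => // /val_inj/perm_inj eq_lr.
  by move: lr; rewrite eq_lr ltnn.
- by apply: eq_coded_affine (coded_affine_mem (pair (r, l))) => s _;
    rewrite dE inversion_setE rl.
- by apply: eq_coded_affine (coded_affine_cst 0) => s _; rewrite ltnn.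
Qed.

End CodedAffine.

Lemma contains_pattern3P n (a b c : nat) (s : 'S_n) :
  reflect (exists i j k : 'I_n, [/\ (i < j)%N, (j < k)%N,
      ((a < b) = (s i < s j)) /\ ((b < a) = (s j < s i)),
      ((b < c) = (s j < s k)) /\ ((c < b) = (s k < s j)) &
      ((a < c) = (s i < s k)) /\ ((c < a) = (s k < s i))])%N
    (contains_pattern [:: a; b; c] s).
Proof.
apply: (iffP existsP) => [[f /andP[/forallP mono /forallP pat]]|].
  have monoE (i j : 'I_3) : (i < j)%N -> (f i < f j)%N by apply: (implyP (forallP (mono i) j)).
  have patE (i j : 'I_3) := eqP (forallP (pat i) j).
  pose o0 : 'I_3 := @Ordinal 3 0 isT; pose o1 : 'I_3 := @Ordinal 3 1 isT.
  pose o2 : 'I_3 := @Ordinal 3 2 isT.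
  exists (f o0), (f o1), (f o2); split; try exact: monoE.
  - by split; [apply: (patE o0 o1) | apply: (patE o1 o0)].
  - by split; [apply: (patE o1 o2) | apply: (patE o2 o1)].
  - by split; [apply: (patE o0 o2) | apply: (patE o2 o0)].
move=> [i [j [k [ij jk [ab ba] [bc cb] [ac ca]]]]].
exists [ffun x : 'I_3 => nth i [:: i; j; k] x]; apply/andP; split;
  apply/forallP => -[[|[|[|x]]] ltx] //; apply/forallP => -[[|[|[|y]]] lty] //;
  rewrite !ffunE /= ?ij ?jk ?(ltn_trans ij jk) //; apply/eqP; rewrite ?ltnn //.
Qed.

(** * Alternating permutations avoiding 123 *)

Section Alternating.
Variable n : nat.
Implicit Types (s t : 'S_n) (i j k l r : 'I_n).

(* The last letter of a permutation of odd size counts as a last peak: it lies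
   below all the peaks, but 123 can be avoided without it lying below the
   previous valleys. *)
Definition valley i : bool := ~~ odd i && (i.+1 < n)%N.

(** A peak [i] has a smaller letter just before it and a valley [j] a larger one just after it;
    either would complete an ascent from [i] to [j] to a 123. Conversely the middle position of a
    123 is a valley, which forbids its first ascent, or not, which forbids its second. *)
Lemma altAv_123P s :
  reflect (forall i j, (i < j)%N ->
      (~~ valley i || valley j -> s j < s i)%N /\
      (valley i -> j = i.+1 :> nat -> s i < s j)%N)
    (s \in altAv_123 n).
Proof.
rewrite inE; apply: (iffP andP) => [[/forallP alt avoid]|good].
  have {}alt i j : j = i.+1 :> nat -> if odd i then (s j < s i)%N else (s i < s j)%N.
    by move=> ji; have := forallP (alt i) j; rewrite ji eqxx.
  have no123 i j k : (i < j)%N -> (j < k)%N -> (s i < s j)%N -> ~~ (s j < s k)%N.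
    move=> ij jk sij; apply: contra avoid => sjk; apply/contains_pattern3P.
    by exists i, j, k; split=> //; split; rewrite /=; lia.
  move=> i j ij; split; last by case/andP=> /negPf ni _ /alt; rewrite ni.
  have neq_s : s i <> s j :> nat.
    by move/val_inj/perm_inj => eq_ij; move: ij; rewrite eq_ij ltnn.
  move=> vij; rewrite ltnNge leq_eqVlt; apply/norP; split; first exact/eqP.
  apply/negP => sij; case/orP: vij => [nvi|/andP[nj ltj]].
    have oi : odd i by move: nvi; rewrite /valley negb_and negbK; have := ltn_ord j; lia.
    have ltp : (i.-1 < n)%N by have := ltn_ord i; lia.
    pose p := Ordinal ltp.
    have ip : i = p.+1 :> nat by rewrite /= prednK // odd_gt0.
    have odd_p : odd p = false by move: oi; rewrite ip /=; case: odd.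
    have := alt p i ip; rewrite odd_p => spi.
    by have := no123 p i j (eq_leq (esym ip)) ij spi; rewrite sij.
  have := alt j (Ordinal ltj) erefl; rewrite (negPf nj) => sjk.
  by have := no123 i j (Ordinal ltj) ij (leqnn _) sij; rewrite sjk.
split.
  apply/forallP => i; apply/forallP => j; apply/implyP => /eqP ji.
  have ij : (i < j)%N by rewrite ji.
  have [inv adj] := good i j ij; case: ifPn => oi; first by rewrite inv // /valley oi.
  by rewrite adj // /valley oi -ji ltn_ord.
apply/negP => /contains_pattern3P[i [j [k [ij jk [/esym sij _] [/esym sjk _] _]]]].
move: sij sjk; rewrite /=; have [vj|nvj] := boolP (valley j).
  by have [+ _] := good i j ij; rewrite vj orbT => /(_ isT); lia.
by have [+ _] := good j k jk; rewrite nvj => /(_ isT); lia.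
Qed.

(** Suppose the conclusion fails. Counting the letters below position [r] yields a [k] with a
    smaller letter than [r] in [t] and a larger one in [s]. Then [l], [r], [k] appear in opposite
    orders in [s] and [t], so no two of them form a forced inversion: any two would be a valley and
    a non-valley, impossible for three positions. *)
Lemma altAv_123_nested s t l r : s \in altAv_123 n -> t \in altAv_123 n ->
  (s r <= t r)%N -> (s l < s r)%N -> (t l < t r)%N.
Proof.
move=> /altAv_123P good_s /altAv_123P good_t le_r slr.
rewrite ltnNge; apply/negP => trl.
have neq_lr : l != r by apply: contraTneq slr => ->; rewrite ltnn.
have {}trl : (t r < t l)%N.
  rewrite ltn_neqAle trl andbT; apply: contraNneq neq_lr.
  by move/val_inj/perm_inj ->.
have [k tkr srk] : exists2 k, (t k < t r)%N & (s r < s k)%N.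
  apply: contrapT => no_k.
  have : [set k | (t k < t r)%N]%SET \proper [set k | (s k < s r)%N]%SET.
    apply/properP; split; last by exists l; rewrite !inE ?slr // -leqNgt ltnW.
    apply/fintype.subsetP => k; rewrite !inE => tkr; rewrite ltn_neqAle leqNgt.
    apply/andP; split; last by apply/negP => srk; apply: no_k; exists k.
    by apply: contraTneq tkr => /val_inj/perm_inj ->; rewrite ltnn.
  by move/proper_card; rewrite !card_below; lia.
have inv_s i j : (i < j)%N -> ~~ valley i || valley j -> (s j < s i)%N.
  by move=> ij; apply: (good_s i j ij).1.
have inv_t i j : (i < j)%N -> ~~ valley i || valley j -> (t j < t i)%N.
  by move=> ij; apply: (good_t i j ij).1.
have neq_kr : k != r by apply: contraTneq tkr => ->; rewrite ltnn.
have neq_kl : k != l by apply: contraTneq tkr => ->; rewrite -leqNgt ltnW.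
have not_s i j : (s i <= s j)%N -> (i < j)%N -> (~~ valley i || valley j) = false.
  by move=> sij ij; apply: contraTF sij => /(inv_s i j ij); rewrite -ltnNge.
have not_t i j : (t i <= t j)%N -> (i < j)%N -> (~~ valley i || valley j) = false.
  by move=> tij ij; apply: contraTF tij => /(inv_t i j ij); rewrite -ltnNge.
have skl := ltnW (ltn_trans slr srk); have tkl := ltnW (ltn_trans tkr trl).
have case_lk : (~~ valley l || valley k) && (~~ valley k || valley l) = false.
  have [/(not_s l k skl) -> //|/(not_t k l tkl) ->|/val_inj eq_lk] := ltngtP l k.
    by rewrite andbF.
  by rewrite eq_lk eqxx in neq_kl.
have case_l : (~~ valley l || valley r) && (~~ valley r || valley l) = false.
  have [/(not_s l r (ltnW slr)) -> //|/(not_t r l (ltnW trl)) ->|/val_inj eq_lr] := ltngtP l r.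
    by rewrite andbF.
  by rewrite eq_lr eqxx in neq_lr.
have case_k : (~~ valley k || valley r) && (~~ valley r || valley k) = false.
  have [/(not_t k r (ltnW tkr)) -> //|/(not_s r k (ltnW srk)) ->|/val_inj eq_kr] := ltngtP k r.
    by rewrite andbF.
  by rewrite eq_kr eqxx in neq_kr.
by move: case_lk case_l case_k; case: (valley l); case: (valley r); case: (valley k).
Qed.

(** The threshold is the least letter at [r] for which the comparison holds; [altAv_123_nested]
    propagates it upwards. If it never holds, [n] is out of reach. *)
Lemma altAv_123_lt_threshold l r : exists c : nat,
  {in altAv_123 n, forall s, (s l < s r)%N = (c <= s r)%N}.
Proof.
have [[s0 /andP[As0 lt_s0]]|none] := pselect (exists s, (s \in altAv_123 n) && (s l < s r)%N).
  case: (@arg_minnP _ s0 (fun s => (s \in altAv_123 n) && (s l < s r)%N)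
    (fun s => s r)) => [|s1 /andP[As1 lt_s1] min_s1]; first by rewrite As0.
  exists (s1 r) => s As; apply/idP/idP => [lt_s|le_s].
    by apply: min_s1; rewrite As.
  exact: altAv_123_nested As1 As le_s lt_s1.
exists n => s As; rewrite [RHS]leqNgt ltn_ord; apply/negP => lt_s.
by apply: none; exists s; rewrite As.
Qed.

(** Let [s0] have the least letter at [r] that is at least [c], and [t0] the greatest below [c].
    More letters lie below position [r] in [s0] than in [t0], so some [l] tells them apart, and
    nestedness extends this to the family. The constant case is that of a missing [s0] or [t0]. *)
Lemma altAv_123_ge_threshold r (c : nat) :
  (exists l, {in altAv_123 n, forall s, (c <= s r)%N = (s l < s r)%N}) \/
  (exists b : bool, {in altAv_123 n, forall s, (c <= s r)%N = b}).
Proof.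
pose hi s := (s \in altAv_123 n) && (c <= s r)%N.
pose lo s := (s \in altAv_123 n) && (s r < c)%N.
have [[s hi_s]|no_hi] := pselect (exists s, hi s); last first.
  right; exists false => s As; apply/negP => cs; apply: no_hi.
  by exists s; rewrite /hi As.
have [[t lo_t]|no_lo] := pselect (exists s, lo s); last first.
  right; exists true => u Au; rewrite leqNgt; apply/negP => uc; apply: no_lo.
  by exists u; rewrite /lo Au.
left; case: (@arg_minnP _ s hi (fun s => s r) hi_s) => s0 /andP[As0 cs0] min_s0.
case: (@arg_maxnP _ t lo (fun s => s r) lo_t) => t0 /andP[At0 ct0] max_t0.
have [l s0l t0l] : exists2 l, (s0 l < s0 r)%N & ~~ (t0 l < t0 r)%N.
  apply: contrapT => no_l.
  have : [set l | (s0 l < s0 r)%N]%SET \subset [set l | (t0 l < t0 r)%N]%SET.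
    apply/fintype.subsetP => l; rewrite !inE => s0l; apply: contraT => t0l.
    by case: no_l; exists l.
  by move/subset_leq_card; rewrite !card_below; lia.
exists l => u Au; apply/idP/idP => [cu|ulr].
  by apply: (altAv_123_nested As0 Au _ s0l); apply: min_s0; rewrite /hi Au.
rewrite leqNgt; apply: contra t0l => uc.
by apply: (altAv_123_nested Au At0 _ ulr); apply: max_t0; rewrite /lo Au.
Qed.

(** For [i < j < k], either [j] is a valley and [(i, j)] is an inversion of both, or it is not and
    [(j, k)] is. With one of these pairs present, biclosedness reduces to a single implication
    between membership of two pairs, which survives intersection and union. *)
Lemma altAv_123_inversion_setI_U s t : s \in altAv_123 n -> t \in altAv_123 n ->
  (exists2 u, u \in altAv_123 n & inversion_set u = inversion_set s :&: inversion_set t)%SET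
  /\ (exists2 u, u \in altAv_123 n & inversion_set u = inversion_set s :|: inversion_set t)%SET.
Proof.
move=> /altAv_123P good_s /altAv_123P good_t.
have [ltEs triEs] := biclosed_inversion_set s.
have [ltEt triEt] := biclosed_inversion_set t.
have forced i j : (i < j)%N -> ~~ valley i || valley j ->
    ((i, j) \in inversion_set s) && ((i, j) \in inversion_set t).
  move=> ij vij; rewrite !inversion_setE ij.
  by rewrite (good_s i j ij).1 // (good_t i j ij).1.
have adjacent i j : valley i -> j = i.+1 :> nat ->
    ((i, j) \notin inversion_set s) && ((i, j) \notin inversion_set t).
  move=> vi ji; have ij : (i < j)%N by rewrite ji.
  rewrite !inversion_setE ij /= -!leqNgt.
  by rewrite (ltnW ((good_s i j ij).2 vi ji)) (ltnW ((good_t i j ij).2 vi ji)).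
have realize u (E : {set 'I_n * 'I_n}) : inversion_set u = E ->
    (forall i j, (i < j)%N -> ~~ valley i || valley j -> (i, j) \in E) ->
    (forall i j, valley i -> j = i.+1 :> nat -> (i, j) \notin E) ->
    u \in altAv_123 n.
  move=> uE inE1 ninE; apply/altAv_123P => i j ij; split=> [vij|vi ji].
    by have := inE1 i j ij vij; rewrite -uE inversion_setE ij.
  have := ninE i j vi ji; rewrite -uE inversion_setE ij /= -leqNgt ltn_neqAle => ->.
  by rewrite andbT; apply: contraTneq ij => /val_inj/perm_inj ->; rewrite ltnn.
split.
  have [|u uE] := @biclosed_realize n (inversion_set s :&: inversion_set t)%SET.
    split=> [p|i j k ij jk]; first by rewrite finset.in_setI => /andP[/ltEs].
    have := triEs i j k ij jk; have := triEt i j k ij jk.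
    have := forced i j ij; have := forced j k jk; rewrite !finset.in_setI.
    case: (valley j); rewrite ?orbT /= => f1 f2;
      [move/(_ isT): f2 => /andP[-> ->] | move/(_ isT): f1 => /andP[-> ->]];
      do 4! [case: (_ \in inversion_set _) => //=]; by case=> ? ? [].
  exists u => //; apply: realize uE _ _ => i j.
    by move=> ij vij; rewrite finset.in_setI forced.
  by move=> vi ji; rewrite finset.in_setI negb_and; case/andP: (adjacent i j vi ji) => ->.
have [|u uE] := @biclosed_realize n (inversion_set s :|: inversion_set t)%SET.
  split=> [p|i j k ij jk].
    by rewrite finset.in_setU => /orP[/ltEs|/ltEt].
  have := triEs i j k ij jk; have := triEt i j k ij jk.
  have := forced i j ij; have := forced j k jk; rewrite !finset.in_setU.
  case: (valley j); rewrite ?orbT /= => f1 f2;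
    [move/(_ isT): f2 => /andP[-> ->] | move/(_ isT): f1 => /andP[-> ->]];
    do 4! [case: (_ \in inversion_set _) => //=]; by case=> ? ? [].
exists u => //; apply: realize uE _ _ => i j.
  by move=> ij vij; rewrite finset.in_setU; case/andP: (forced i j ij vij) => ->.
by move=> vi ji; rewrite finset.in_setU negb_or adjacent.
Qed.

Lemma altAv_123_coding :
  order_coding (@left_weak_le n) (altAv_123 n) (@inversion_set n).
Proof.
have memE s p : (id p \in inversion_set s) = (p \in inversion_set s) by [].
have lt_aff l r : coded_affine (altAv_123 n) (@inversion_set n)
    (fun s => (s l < s r)%N%:Z) := @coded_affine_lt _ _ _ _ id l r id memE.
split.
- move=> [i j]; have [c cE] := altAv_123_lt_threshold j i.
  have [ij|ji] := ltnP i j; last first.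
    by apply: eq_int_affine (int_affine_cst _ 0) => s _; rewrite inversion_setE ltnNge ji.
  (* The inversion is the condition [c <= s i], hence the sum of the entries of row [i] from column
     [c] on. *)
  apply: (@eq_int_affine _ _ (fun s => \sum_(k < n | (c <= k)%N) (s i == k)%:Z)) => [s As|].
    rewrite inversion_setE ij cE //=; have [le_c|lt_c] := boolP (c <= s i)%N.
      by rewrite (bigD1 (s i)) //= eqxx big1 ?addr0 // => k /andP[_ /negPf]; rewrite eq_sym => ->.
    by rewrite big1 // => k ck; case: eqP => // sk; rewrite sk ck in lt_c.
  by apply: int_affine_sum => k _; apply: int_affine_entry.
- move=> r c; have ge_aff (k : nat) : coded_affine (altAv_123 n) (@inversion_set n)
      (fun s => (k <= s r)%N%:Z).
    have [[l lE]|[b bE]] := altAv_123_ge_threshold r k.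
      by apply: eq_coded_affine (lt_aff l r) => s As; rewrite lE.
    by apply: eq_coded_affine (coded_affine_cst _ _ b%:Z) => s As; rewrite bE.
  suff: coded_affine (altAv_123 n) (@inversion_set n) (fun s => (s r == c)%:Z) by [].
  apply: eq_coded_affine (coded_affineB (ge_aff c) (ge_aff c.+1)) => s _.
  by rewrite perm_entryB.
- by move=> s t As At; have [] := altAv_123_inversion_setI_U As At.
- by move=> s t As At; have [] := altAv_123_inversion_setI_U As At.
- by move=> s t _ _; apply: left_weak_le_inversion_set.
- by move=> s t _ _; apply: left_weak_le_lex.
Qed.

End Alternating.

(** * Permutations avoiding 132 and 312 *)

Section PrefixIntervals.
Variable n : nat.
Implicit Types (s t v : 'S_n) (a b c l r : 'I_n).

(** Both patterns put the middle one of three values last, after the other two in either order.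
    Avoiding both says that if the middle value comes after the largest, it comes before the
    smallest. *)
Lemma Av_132_312P s :
  reflect (forall a b c, (a < b)%N -> (b < c)%N ->
      (b, c) \in inversion_set s^-1%g -> (a, b) \in inversion_set s^-1%g)
    (s \in Av_132_312 n).
Proof.
rewrite inE; apply: (iffP andP) => [[no132 no312] a b c ab bc|good].
  rewrite !inversion_setE ab bc /= => vcb; rewrite ltnNge; apply/negP => vab.
  have {}vab : (s^-1%g a < s^-1%g b)%N.
    rewrite ltn_neqAle vab andbT; apply: contraTneq ab => /val_inj/perm_inj ->.
    by rewrite ltnn.
  have [vac|vca|/val_inj/perm_inj eq_ac] := ltngtP (s^-1%g a) (s^-1%g c).
  - case/negP: no132; apply/contains_pattern3P.
    exists (s^-1%g a), (s^-1%g c), (s^-1%g b); rewrite !permKV.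
    by split=> //; split; rewrite /=; lia.
  - case/negP: no312; apply/contains_pattern3P.
    exists (s^-1%g c), (s^-1%g a), (s^-1%g b); rewrite !permKV.
    by split=> //; split; rewrite /=; lia.
  - by move: ab bc; rewrite eq_ac; lia.
split; apply/negP => /contains_pattern3P[i [j [k [ij jk]]]] /=.
  move=> [/esym sij _] [_ /esym skj] [/esym sik _].
  have := good (s i) (s k) (s j) sik skj; rewrite !inversion_setE !permK sik skj /=.
  by move/(_ jk); lia.
move=> [_ /esym sji] [/esym sjk _] [_ /esym ski].
have := good (s j) (s k) (s i) sjk ski; rewrite !inversion_setE !permK sjk ski /=.
by move/(_ (ltn_trans ij jk)); lia.
Qed.

(* The values preceding c form an interval ending at c - 1 or starting at
   c + 1, so there are at least m of them iff c - m or c + m is one. *)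
Lemma Av_132_312_position s (m : nat) c : s \in Av_132_312 n -> (0 < m)%N ->
  (m <= s^-1%g c)%N%:Z =
    \sum_(l < n | (l + m)%N == c) (s^-1%g l < s^-1%g c)%N%:Z +
    \sum_(l < n | l == (c + m)%N :> nat) (s^-1%g l < s^-1%g c)%N%:Z.
Proof.
move=> /Av_132_312P; set v := (s^-1)%g => good m_gt0.
have {}good a b (d : 'I_n) : (a < b)%N -> (b < d)%N -> (v d < v b)%N -> (v b < v a)%N.
  by move=> ab bd; have := good a b d ab bd; rewrite !inversion_setE ab bd.
have neq_v a b : (a < b)%N -> v a <> v b :> nat.
  by move=> ab /val_inj/perm_inj eq_ab; move: ab; rewrite eq_ab ltnn.
have up a b : (a < b)%N -> (b < c)%N -> (v a < v c)%N -> (v b < v c)%N.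
  by move=> ab bc; have := good a b c ab bc; have := neq_v b c bc; lia.
have down a b : (c < a)%N -> (a < b)%N -> (v b < v c)%N -> (v a < v c)%N.
  by move=> ca ab; have := good c a b ca ab; lia.
(* Otherwise [c] would be the middle value of [a], [c], [b] and come last. *)
have one_side a b : (a < c)%N -> (c < b)%N -> (v a < v c)%N -> ~~ (v b < v c)%N.
  by move=> ac cb; have := good a c b ac cb; lia.
have sub_below (x y : nat) : (y <= n)%N ->
    (forall l, (x <= l < y)%N -> (v l < v c)%N) -> (y - x <= v c)%N.
  move=> yn sub; rewrite -(card_ord_interval x yn) -(card_below v c).
  by apply: subset_leq_card; apply/fintype.subsetP => l; rewrite !inE; apply: sub.
have below_sub (x y : nat) : (y <= n)%N ->
    (forall l, (v l < v c)%N -> (x <= l < y)%N) -> (v c <= y - x)%N.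
  move=> yn sub; rewrite -(card_ord_interval x yn) -(card_below v c).
  by apply: subset_leq_card; apply/fintype.subsetP => l; rewrite !inE; apply: sub.
have ltc := ltn_ord c.
have not_c l : (v l < v c)%N -> l <> c :> nat.
  by move=> + /val_inj eq_lc; rewrite eq_lc ltnn.
have [[l0 /andP[l0c vl0]]|none] := pselect (exists l, (l < c)%N && (v l < v c)%N).
  rewrite [X in _ = _ + X]big1 => [|l /eqP lE]; last first.
    by rewrite (negPf (one_side l0 l _ _ _)) //; lia.
  have below_c l : (v l < v c)%N -> (l < c)%N.
    by move=> vl; have := not_c l vl; have := one_side l0 l l0c; rewrite vl => /(_ _ vl0); lia.
  rewrite addr0; have [mc|cm] := leqP m c; last first.
    rewrite big1 => [|l /eqP lE]; last by move: cm; rewrite -lE; lia.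
    by rewrite leqNgt (leq_ltn_trans (below_sub 0%N c (ltnW ltc) below_c)) ?subn0.
  have ltd : (c - m < n)%N by lia.
  rewrite (big_pred1 (Ordinal ltd)) => [|l]; last by rewrite /= -(inj_eq val_inj) /=; lia.
  have [vd|nvd] := boolP (v (Ordinal ltd) < v c)%N.
    have := sub_below (c - m)%N c (ltnW ltc); rewrite subKn // => -> // l /andP[dl lc].
    have [dl'|dl'|dl'] := ltngtP (Ordinal ltd) l; last by rewrite -(val_inj dl').
      exact: up dl' lc vd.
    by move: dl'; rewrite /=; lia.
  suff le_v : (v c <= c - (c - m).+1)%N by rewrite leqNgt (leq_ltn_trans le_v) //; lia.
  apply: below_sub => [|l vl]; first exact: ltnW.
  rewrite (below_c l vl) andbT ltnNge; apply: contra nvd => ld.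
  have [dl'|dl'|dl'] := ltngtP l (Ordinal ltd); last by rewrite -(val_inj dl').
    by apply: up dl' _ vl; rewrite /=; lia.
  by move: dl'; rewrite /=; lia.
rewrite [X in _ = X + _]big1 => [|l /eqP lE]; last first.
  case: ltnP => // vl; case: none; exists l; rewrite vl andbT; lia.
have above_c l : (v l < v c)%N -> (c < l)%N.
  move=> vl; have := not_c l vl; case: (ltnP l c) => [lc|]; last by lia.
  by case: none; exists l; rewrite lc.
rewrite add0r; have [cm|cm] := ltnP (c + m) n; last first.
  rewrite big1 => [|l /eqP lE]; last by have := ltn_ord l; lia.
  suff le_v : (v c <= n - c.+1)%N by rewrite leqNgt (leq_ltn_trans le_v) //; lia.
  by apply: below_sub => // l /above_c ->; rewrite ltn_ord.
rewrite (big_pred1 (Ordinal cm)) => [|l]; last by rewrite /= -(inj_eq val_inj).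
have [vd|nvd] := boolP (v (Ordinal cm) < v c)%N.
  have := sub_below c.+1 (c + m).+1 cm; rewrite subSS addKn => -> // l /andP[cl ld].
  have [dl'|dl'|dl'] := ltngtP l (Ordinal cm); last by rewrite (val_inj dl').
    exact: down cl dl' vd.
  by move: dl'; rewrite /=; lia.
suff le_v : (v c <= c + m - c.+1)%N by rewrite leqNgt (leq_ltn_trans le_v) //; lia.
apply: below_sub => [|l vl]; first exact: ltnW.
 rewrite (above_c l vl) /= ltnNge; apply: contra nvd => ld.
have [dl'|dl'|dl'] := ltngtP (Ordinal cm) l; last by rewrite (val_inj dl').
  by apply: down _ dl' vl; rewrite /=; lia.
by move: dl'; rewrite /=; lia.
Qed.

(** Apply the position formula to the value [a] with [m = b - a]. Its second sum is the inversion
    [(a, b)]; its first compares [a] with the value [a - m], if there is one, an inversion with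
    smaller first component that the induction covers. *)
Lemma Av_132_312_int_affine a b :
  int_affine (Av_132_312 n) (fun s => ((a, b) \in inversion_set s^-1%g)%:Z).
Proof.
have [k] := ubnP (val a); elim: k a b => // k IHk a b ltk.
have [ab|ba] := ltnP a b; last first.
  by apply: eq_int_affine (int_affine_cst _ 0) => s _; rewrite inversion_setE ltnNge ba.
pose m := (b - a)%N; have m_gt0 : (0 < m)%N by rewrite /m; lia.
apply: (@eq_int_affine _ _ (fun s => \sum_(r < n | (m <= r)%N) (s r == a)%:Z -
  \sum_(l < n | (l + m)%N == a) (1 - ((l, a) \in inversion_set s^-1%g)%:Z))); last first.
  apply: int_affineB; first by apply: int_affine_sum => r _; apply: int_affine_entry.
  apply: int_affine_sum => l /eqP lE; apply: int_affineB; first exact: int_affine_cst.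
  by apply: IHk; move: ltk lE m_gt0; rewrite /=; lia.
move=> s As; apply/eqP; rewrite subr_eq; apply/eqP.
have -> : \sum_(r < n | (m <= r)%N) (s r == a)%:Z = (m <= s^-1%g a)%N%:Z :> int.
  have [le_m|lt_m] := leqP m (s^-1%g a).
    rewrite (bigD1 (s^-1%g a)) //= permKV eqxx big1 ?addr0 // => r /andP[_].
    by rewrite eq_sym (canF_eq (permKV s)) eq_sym => /negPf ->.
  rewrite big1 // => r mr; case: eqP => // sra; move: lt_m.
  by rewrite -sra permK ltnNge mr.
rewrite Av_132_312_position // addrC; congr (_ + _).
  rewrite (big_pred1 b) => [|l]; last first.
    by rewrite /= -(inj_eq val_inj) /=; congr (_ == _); rewrite /m; lia.
  by rewrite inversion_setE ab.
apply: eq_bigr => l /eqP lE; have la : (l < a)%N by rewrite -lE; lia.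
rewrite inversion_setE la /=; case: ltngtP => // /val_inj/perm_inj eq_la.
by move: la; rewrite eq_la ltnn.
Qed.

Lemma Av_132_312_entry_coded r c : coded_affine (Av_132_312 n)
  (fun s => inversion_set s^-1%g) (fun s => (s r == c)%:Z).
Proof.
have pos_aff (m : nat) : coded_affine (Av_132_312 n) (fun s => inversion_set s^-1%g)
    (fun s => (m <= s^-1%g c)%N%:Z).
  (* At [m = 0] the formula would compare [c] with itself and give 0 instead of 1. *)
  have [->|m_gt0] := posnP m; first by apply: eq_coded_affine (coded_affine_cst _ _ 1) => s _.
  have lt_aff l := @coded_affine_lt _ (Av_132_312 n) _ (fun s => inversion_set s^-1%g)
    (fun s => s^-1%g) l c id (fun _ _ => erefl).
  apply: eq_coded_affine (coded_affineD (coded_affine_sum _ (P := fun l => (l + m)%N == c)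
    (fun l _ => lt_aff l)) (coded_affine_sum _ (P := fun l => l == (c + m)%N :> nat)
    (fun l _ => lt_aff l))) => s As.
  by rewrite Av_132_312_position.
apply: eq_coded_affine (coded_affineB (pos_aff r) (pos_aff r.+1)) => s _.
rewrite -perm_entryB; congr (_%:Z); congr nat_of_bool.
by apply/eqP/eqP => [<-|<-]; rewrite ?permK ?permKV.
Qed.

(** For [i < j < k], avoidance and biclosedness together say that membership of [(j, k)] implies
    that of [(i, k)], which implies that of [(i, j)]. Such chains of implications survive
    intersection and union. *)
Lemma Av_132_312_inversion_setI_U s t : s \in Av_132_312 n -> t \in Av_132_312 n ->
  (exists2 u, u \in Av_132_312 n &
    inversion_set u^-1%g = inversion_set s^-1%g :&: inversion_set t^-1%g)%SET
  /\ (exists2 u, u \in Av_132_312 n &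
    inversion_set u^-1%g = inversion_set s^-1%g :|: inversion_set t^-1%g)%SET.
Proof.
move=> /Av_132_312P good_s /Av_132_312P good_t.
have [ltEs triEs] := biclosed_inversion_set s^-1%g.
have [ltEt triEt] := biclosed_inversion_set t^-1%g.
split.
  have [|v vE] := @biclosed_realize n (inversion_set s^-1%g :&: inversion_set t^-1%g)%SET.
    split=> [p|i j k ij jk]; first by rewrite finset.in_setI => /andP[/ltEs].
    have := triEs i j k ij jk; have := triEt i j k ij jk.
    have := good_s i j k ij jk; have := good_t i j k ij jk; rewrite !finset.in_setI.
    do 6! [case: (_ \in inversion_set _) => //=]; by move=> H1 H2; case=> ? ? [] ? ?; auto.
  exists v^-1%g; rewrite ?invgK //; apply/Av_132_312P => a b c ab bc.
  rewrite invgK vE !finset.in_setI => /andP[/(good_s a b c ab bc) -> ].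
  exact: good_t.
have [|v vE] := @biclosed_realize n (inversion_set s^-1%g :|: inversion_set t^-1%g)%SET.
  split=> [p|i j k ij jk]; first by rewrite finset.in_setU => /orP[/ltEs|/ltEt].
  have := triEs i j k ij jk; have := triEt i j k ij jk.
  have := good_s i j k ij jk; have := good_t i j k ij jk; rewrite !finset.in_setU.
  do 6! [case: (_ \in inversion_set _) => //=]; by move=> H1 H2; case=> ? ? [] ? ?; auto.
exists v^-1%g; rewrite ?invgK //; apply/Av_132_312P => a b c ab bc.
rewrite invgK vE !finset.in_setU => /orP[/(good_s a b c ab bc) -> //|].
by move/(good_t a b c ab bc) ->; rewrite orbT.
Qed.

Lemma Av_132_312_coding :
  order_coding (@right_weak_le n) (Av_132_312 n) (fun s => inversion_set s^-1%g).
Proof.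
split.
- by move=> [a b]; apply: Av_132_312_int_affine.
- exact: Av_132_312_entry_coded.
- by move=> s t As At; have [] := Av_132_312_inversion_setI_U As At.
- by move=> s t As At; have [] := Av_132_312_inversion_setI_U As At.
- by move=> s t _ _; rewrite right_weak_le_inv left_weak_le_inversion_set.
- by move=> s t _ _; apply: right_weak_le_lex.
Qed.

End PrefixIntervals.

Theorem theorem5p11 (R : realType) (K : fieldType) (n : nat) :
  (let A := Av_132_312 n in
   let B := perm_polytope A : set 'M[R]_n in
   let T := chain_cells (@right_weak_le n) A : set (set 'M[R]_n) in
   [/\ triangulation B T,
       regular B T,
       flag T,
       unimodular (affine_hull B `&` @integer_points R n) T
     & reverse_lexicographic K A T]) /\
  (let A := altAv_123 n in
   let B := perm_polytope A : set 'M[R]_n in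
   let T := chain_cells (@left_weak_le n) A : set (set 'M[R]_n) in
   [/\ triangulation B T,
       regular B T,
       flag T,
       unimodular (affine_hull B `&` @integer_points R n) T
     & reverse_lexicographic K A T]).
Proof.
split.
  have cod := Av_132_312_coding n; split.
  - exact: coded_triangulation cod.
  - exact: coded_regular cod.
  - exact: coded_flag cod.
  - exact: coded_unimodular cod.
  - exact: coded_reverse_lexicographic cod.
have cod := altAv_123_coding n; split.
- exact: coded_triangulation cod.
- exact: coded_regular cod.
- exact: coded_flag cod.
- exact: coded_unimodular cod.
- exact: coded_reverse_lexicographic cod.
Qed.
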